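(* Let $n\ge1$, $\delta>0$, $\beta<n+2$, $\mu,\lambda^*\in\mathbb{R}$, and $\nu\in\mathbb{R}^n$. The eigenvalue $\lambda_1(\nu)$ of $M^{\delta,\beta}(\nu)$ associated with the direction of $\nu$ is $$\lambda_1(\nu)=-\|\nu\|^2\Bigg(3\mu\;{}_3F_4\left(1,\tfrac52,\tfrac{n+2-\beta}{2};2,\tfrac32,\tfrac{n+4}{2},\tfrac{n+4-\beta}{2};-\tfrac14\|\nu\|^2\delta^2\right)+(\lambda^*-\mu)\;{}_1F_2\left(\tfrac{n+2-\beta}{2};\tfrac{n+2}{2},\tfrac{n+4-\beta}{2};-\tfrac14\|\nu\|^2\delta^2\right)^2\Bigg),$$ and the eigenvalue $\lambda_2(\nu)$ of $M^{\delta,\beta}(\nu)$ associated with directions orthogonal to $\nu$ is $$\lambda_2(\nu)=-\mu\|\nu\|^2\;{}_2F_3\left(1,\tfrac{n+2-\beta}{2};2,\tfrac{n+4}{2},\tfrac{n+4-\beta}{2};-\tfrac14\|\nu\|^2\delta^2\right).$$ That is, with these values, $M^{\delta,\beta}(\nu)\nu=\lambda_1(\nu)\nu$, and $M^{\delta,\beta}(\nu)\eta=\lambda_2(\nu)\eta$ for every $\eta\in\mathbb{R}^n$ with $\eta\cdot\nu=0$.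
   Context: $B_\delta(0)$ is the ball of radius $\delta$ centered at $0$ in $\mathbb{R}^n$; $v\otimes w$ is the matrix with entries $v_iw_j$. With $$c^{\delta,\beta}=\left(\frac{1}{2n}\int_{B_\delta(0)}\frac{\|w\|^2}{\|w\|^\beta}\,dw\right)^{-1}=\frac{2(n+2-\beta)\Gamma\left(\frac n2+1\right)}{\pi^{n/2}\delta^{n+2-\beta}},$$ the multiplier of the linear peridynamic operator is the $n\times n$ matrix $M^{\delta,\beta}(\nu)=M_b(\nu)+M_s(\nu)$, where $$M_b(\nu)=(n+2)\,\mu\,c^{\delta,\beta}\int_{B_\delta(0)}\frac{w\otimes w}{\|w\|^{\beta+2}}\big(\cos(\nu\cdot w)-1\big)\,dw,$$ $$M_s(\nu)=-(\lambda^*-\mu)\frac{(c^{\delta,\beta})^2}{4}\left(\int_{B_\delta(0)}\frac{w}{\|w\|^\beta}\sin(\nu\cdot w)\,dw\right)\otimes\left(\int_{B_\delta(0)}\frac{w}{\|w\|^\beta}\sin(\nu\cdot w)\,dw\right).$$ Generalized hypergeometric function: ${}_pF_q(a_1,\dots,a_p;b_1,\dots,b_q;z)=\sum_{k\ge0}\frac{(a_1)_k\cdots(a_p)_k}{(b_1)_k\cdots(b_q)_k}\frac{z^k}{k!}$ with $(a)_k=a(a+1)\cdots(a+k-1)$. *)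

(* Defs.v *)
From HB Require Import structures.
From mathcomp Require Import all_boot all_order all_algebra.
From mathcomp Require Import all_classical all_reals all_analysis.

Set Implicit Arguments.
Unset Strict Implicit.
Unset Printing Implicit Defensive.
Import Order.TTheory GRing.Theory Num.Theory.
Import numFieldNormedType.Exports.

Local Open Scope classical_set_scope.
Local Open Scope ring_scope.

(* Packs a proof of sigma-finiteness, which cannot be inferred canonically for a
   pushforward. *)
Definition with_sigma_finite d (T : measurableType d) (R : realType)
  (p : {measure set T -> \bar R}) of sigma_finite setT p : set T -> \bar R := p.

Section with_sigma_finite.
Context d (T : measurableType d) (R : realType).
Variables (p : {measure set T -> \bar R}) (psf : sigma_finite setT p).

HB.instance Definition _ := isMeasure.Build _ _ _ (with_sigma_finite psf)
  (measure0 p) (measure_ge0 p) (@measure_semi_sigma_additive _ _ _ p).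
HB.instance Definition _ :=
  Measure_isSigmaFinite.Build _ _ _ (with_sigma_finite psf) psf.

End with_sigma_finite.

Section lebesgue_tuple.
Variable R : realType.

Definition tcons n (p : measurableTypeR R * n.-tuple (measurableTypeR R)) :
  n.+1.-tuple (measurableTypeR R) := [tuple of p.1 :: p.2].

(* Lebesgue measure on R^n: the n-fold product of the one-dimensional Lebesgue
   measure. Elements of R^n are tuples here because n.-tuple carries the product
   sigma-algebra, i.e. the Borel sets. *)
Fixpoint lebesgue_tuple n : set (n.-tuple (measurableTypeR R)) -> \bar R :=
  match n with
  | 0 => dirac [tuple]
  | n'.+1 => pushforward
      (product_measure1 (@lebesgue_measure R) (@lebesgue_tuple n')) (@tcons n')
  end.

Lemma measurable_tcons n : measurable_fun setT (@tcons n).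
Proof. exact: measurable_cons. Qed.

Let tuncons n (w : n.+1.-tuple (measurableTypeR R)) :
  measurableTypeR R * n.-tuple (measurableTypeR R) :=
  (tnth w ord0, [tuple of behead w]).

Let tconsK n : cancel (@tcons n) (@tuncons n).
Proof. by move=> [x w]; congr pair => //; exact/val_inj. Qed.

Let measurable_tuncons n : measurable_fun setT (@tuncons n).
Proof.
apply/measurable_fun_pairP; split; first exact: measurable_tnth.
exact: measurable_behead.
Qed.

Let lebesgue_tuple_ex n :
  exists m :
      {sigma_finite_measure set (n.-tuple (measurableTypeR R)) -> \bar R},
    (m : set _ -> \bar R) = @lebesgue_tuple n.
Proof.
elim: n => [|n [m mE]]; first by exists (dirac [tuple]).
pose q : {measure set (n.+1.-tuple (measurableTypeR R)) -> \bar R} :=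
  pushforward (product_measure1 (@lebesgue_measure R) m) (@tcons n).
pose p : {measure set (n.+1.-tuple (measurableTypeR R)) -> \bar R} :=
  q (@measurable_tcons n).
have qsf : sigma_finite setT p.
  have /sigma_finiteP[F [TF ndF Foo]] := sigma_finiteT (@lebesgue_measure R).
  have /sigma_finiteP[G [TG ndG Goo]] := sigma_finiteT m.
  exists (fun k => @tuncons n @^-1` (F k `*` G k)).
    rewrite -preimage_bigcup [X in _ @^-1` X](_ : _ = setT) ?preimage_setT//.
    rewrite -subTset => -[x y] _.
    have [i _ Fx] : (\bigcup_i F i) x by rewrite -TF.
    have [j _ Gy] : (\bigcup_i G i) y by rewrite -TG.
    exists (maxn i j) => //; split => /=.
      by move: Fx; exact/subsetPset/ndF/leq_maxl.
    by move: Gy; exact/subsetPset/ndG/leq_maxr.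
  move=> k; have [mF Fk] := Foo k; have [mG Gk] := Goo k; split.
    rewrite -[X in measurable X]setTI; apply: measurable_tuncons => //.
    exact: measurableX.
  rewrite /p /q /= /pushforward -comp_preimage.
  rewrite (_ : _ @^-1` _ = F k `*` G k) ?product_measure1E//.
    by rewrite lte_mul_pinfty// ge0_fin_numE.
  apply/funext => -[x w]; rewrite /preimage /=.
  by congr (_ /\ G k _); exact/val_inj.
by exists (with_sigma_finite qsf); rewrite /= -mE.
Qed.

Let lt0 n : @lebesgue_tuple n set0 = 0%E.
Proof. by have [m <-] := lebesgue_tuple_ex n; exact: measure0. Qed.

Let lt_ge0 n A : (0 <= @lebesgue_tuple n A)%E.
Proof. by have [m <-] := lebesgue_tuple_ex n; exact: measure_ge0. Qed.

Let lt_sigma n : semi_sigma_additive (@lebesgue_tuple n).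
Proof.
by have [m <-] := lebesgue_tuple_ex n; exact: measure_semi_sigma_additive.
Qed.

Let lt_sfin n : sigma_finite setT (@lebesgue_tuple n).
Proof. by have [m <-] := lebesgue_tuple_ex n; exact: sigma_finiteT. Qed.

HB.instance Definition _ n := isMeasure.Build _ _ _ (@lebesgue_tuple n)
  (@lt0 n) (@lt_ge0 n) (@lt_sigma n).
HB.instance Definition _ n := Measure_isSigmaFinite.Build _ _ _
  (@lebesgue_tuple n) (@lt_sfin n).

Lemma lebesgue_tuple_box n (A : 'I_n -> set (measurableTypeR R)) :
  (forall i, measurable (A i)) ->
  @lebesgue_tuple n [set w | forall i, A i (tnth w i)] =
  (\prod_(i < n) lebesgue_measure (A i))%E.
Proof.
elim: n A => [|n IH] A mA.
  rewrite big_ord0 /= diracE (_ : _ \in _ = true)//.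
  by apply/mem_set => -[].
rewrite big_ord_recl -IH//= /pushforward.
rewrite -product_measure1E//.
  congr (_ _); apply/seteqP; split => -[x w] /=.
    move=> h; split; first exact: (h ord0).
    by move=> i; have := h (lift ord0 i); rewrite tnthS.
  by move=> [h0 h] i; case: (unliftP ord0 i) => [j ->|->//]; rewrite tnthS.
rewrite (_ : mkset _ =
    \bigcap_(i : 'I_n) (@tnth n _ ^~ i @^-1` A (lift ord0 i))).
  apply: fin_bigcap_measurable => // i _.
  by rewrite -[X in measurable X]setTI; exact: measurable_tnth.
by apply/seteqP; split => w /= h i; [move=> _; exact: h|exact: h].
Qed.

End lebesgue_tuple.

Section hypergeometric.
Variable R : realType.

Definition pochhammer (a : R) (k : nat) : R := \prod_(i < k) (a + i%:R).

(* 'a' and 'b' list the numerator and denominator parameters, so that p and q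
   are their lengths. *)
Definition pFq (a b : seq R) (z : R) : R :=
  limn (series (fun k : nat =>
    (\prod_(x <- a) pochhammer x k) / (\prod_(y <- b) pochhammer y k) *
    (z ^+ k / k`!%:R))).

End hypergeometric.

Section peridynamic_multiplier.
Variables (R : realType) (n : nat).
Implicit Types (u v w nu : 'cV[R]_n) (delta beta mu lambda : R).

Definition dotv u v : R := \sum_i u i 0 * v i 0.

(* The library norm `|v| on matrices is the sup norm. *)
Definition enorm v : R := Num.sqrt (dotv v v).

Definition outer u v : 'M[R]_n := \matrix_(i, j) (u i 0 * v j 0).

Definition tvec (w : n.-tuple (measurableTypeR R)) : 'cV[R]_n :=
  \col_i (tnth w i : R).

Definition ball_int delta (f : 'cV[R]_n -> R) : R :=
  \int[@lebesgue_tuple R n]_(w in [set w | enorm (tvec w) < delta]) f (tvec w).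

Definition ball_int_mx p q delta (F : 'cV[R]_n -> 'M[R]_(p, q)) :
  'M[R]_(p, q) := \matrix_(i, j) ball_int delta (fun w => F w i j).

(* In the kernels below, w = 0 (where powR and division take default values)
   is a null set. *)
Definition cdb delta beta : R :=
  ((2 * n%:R)^-1 *
   ball_int delta (fun w => enorm w ^+ 2 / enorm w `^ beta))^-1.

Definition M_b delta beta mu nu : 'M[R]_n :=
  ((n%:R + 2) * mu * cdb delta beta) *:
  ball_int_mx delta
    (fun w => ((cos (dotv nu w) - 1) / enorm w `^ (beta + 2)) *: outer w w).

Definition sin_int delta beta nu : 'cV[R]_n :=
  ball_int_mx delta (fun w => (sin (dotv nu w) / enorm w `^ beta) *: w).

Definition M_s delta beta mu lambda nu : 'M[R]_n :=
  (- (lambda - mu) * (cdb delta beta ^+ 2 / 4)) *: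
  outer (sin_int delta beta nu) (sin_int delta beta nu).

Definition multiplier delta beta mu lambda nu : 'M[R]_n :=
  M_b delta beta mu nu + M_s delta beta mu lambda nu.

End peridynamic_multiplier.

(* Main.v *)
Require Import Defs.
From HB Require Import structures.
From mathcomp Require Import all_boot all_order all_algebra.
From mathcomp Require Import all_classical all_reals all_analysis.
From mathcomp Require Import measurable_realfun.
From mathcomp Require Import ring lra zify.

Set Implicit Arguments.
Unset Strict Implicit.
Unset Printing Implicit Defensive.
Import Order.TTheory GRing.Theory Num.Theory.
Import numFieldNormedType.Exports.

Local Open Scope classical_set_scope.
Local Open Scope ring_scope.

(* Lebesgue measure on R^n is invariant under orthogonal maps, so that the
   integral over the ball of (xi.w)^(2k+2) / |w|^gam is |xi|^(2k+2) times a
   constant s_k(gam). Replacing xi by nu + t zeta and comparing the coefficients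
   of t gives the integrals of (nu.w)^(2k+1) (zeta.w) / |w|^gam; repeating this
   with nu + t eta, for eta orthogonal to nu, gives those of
   (nu.w)^(2k) (eta.w) (zeta.w) / |w|^gam. Summing the latter over an orthonormal
   basis yields (n + 2k + 2) s_(k+1)(gam) = (2k + 3) s_k(gam - 2), which reduces
   every s_k to integrals of powers of |w|. These are determined up to a common
   factor by homogeneity: the integral of |w|^p is proportional to
   delta^(n+p) / (n + p). Since c^(delta,beta) is itself the inverse of such an
   integral, the volume of the ball never needs to be known. Expanding sin and
   cos and integrating termwise by dominated convergence gives the
   hypergeometric series. *)

(** * Linear changes of variables *)

Section affine_line.
Variable R : realType.
Implicit Types (a b : R) (f : measurableTypeR R -> \bar R).

Let affine a b (x : measurableTypeR R) : measurableTypeR R := a * (x : R) + b.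

Let measurable_affine a b : measurable_fun setT (affine a b).
Proof. by apply: measurable_funD => //; exact: measurable_funM. Qed.

(** By uniqueness of Lebesgue measure it is enough to compare lengths on the intervals []l, r]]. *)
Lemma lebesgue_measure_affine a b (A : set (measurableTypeR R)) : a != 0 ->
  measurable A ->
  (lebesgue_measure A = `|a|%:E * lebesgue_measure (affine a b @^-1` A))%E.
Proof.
move=> a0.
pose mu : {measure set (measurableTypeR R) -> \bar R} :=
  pushforward (@lebesgue_measure R) (affine a b).
apply: (@lebesgue_measure_unique R (mscale (NngNum (normr_ge0 a))
  (mu (measurable_affine a b)))) => _ [[l r] _ <-] /=.
rewrite /mscale/= /pushforward lebesgue_measure_itv/= lte_fin.
have [a_gt0|a_lt0|/eqP] := ltgtP 0 a; last by rewrite eq_sym (negbTE a0).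
- have -> : affine a b @^-1` `]l, r] = `](l - b) / a, (r - b) / a]%classic.
    apply/seteqP; split => x /=; rewrite !in_itv/= /affine.
      by rewrite ltr_pdivrMr// ler_pdivlMr// ltrBlDr lerBrDr mulrC.
    by rewrite ltr_pdivrMr// ler_pdivlMr// ltrBlDr lerBrDr mulrC.
  rewrite lebesgue_measure_itv/= lte_fin ltr_pM2r ?invr_gt0// ltrD2r.
  case: ifPn => // _; last by rewrite mule0.
  by rewrite -!EFinB -EFinM gtr0_norm//; congr EFin; field.
(* A negative slope reverses the interval and swaps its closed end, which leaves the length formula
   intact. *)
- have -> : affine a b @^-1` `]l, r] = `[(r - b) / a, (l - b) / a[%classic.
    apply/seteqP; split => x /=; rewrite !in_itv/= /affine.
      by rewrite ltr_ndivlMr// ler_ndivrMr// ltrBlDr lerBrDr mulrC andbC.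
    by rewrite ltr_ndivlMr// ler_ndivrMr// ltrBlDr lerBrDr mulrC andbC.
  rewrite lebesgue_measure_itv/= lte_fin ltr_nM2r ?invr_lt0// ltrD2r.
  case: ifPn => // _; last by rewrite mule0.
  by rewrite -!EFinB -EFinM ltr0_norm//; congr EFin; field.
Qed.

Lemma ge0_integral_affine a b f : a != 0 -> measurable_fun setT f ->
  (forall x, 0 <= f x)%E ->
  (`|a|%:E * \int[@lebesgue_measure R]_x f (a * (x : R) + b)%R =
   \int[@lebesgue_measure R]_x f x)%E.
Proof.
move=> a0 mf f0.
pose mu : {measure set (measurableTypeR R) -> \bar R} :=
  pushforward (@lebesgue_measure R) (affine a b).
rewrite [RHS](@eq_measure_integral _ _ _ _
  (mscale (NngNum (normr_ge0 a)) (mu (measurable_affine a b)))); last first.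
  by move=> A mA _; exact: lebesgue_measure_affine.
rewrite ge0_integral_mscale//=; congr (_ * _)%E.
by rewrite ge0_integral_pushforward.
Qed.

End affine_line.

(** * Change of variables under invertible matrices *)

Section tuples.
Variable R : realType.
Local Notation T n := (n.-tuple (measurableTypeR R)).

Definition vtup n (v : 'cV[R]_n) : T n := [tuple v i 0 | i < n].

Lemma vtupK n : cancel (@vtup n) (@tvec R n).
Proof. by move=> v; apply/colP => i; rewrite mxE tnth_mktuple. Qed.

Lemma tvecK n : cancel (@tvec R n) (@vtup n).
Proof. by move=> w; apply: eq_from_tnth => i; rewrite tnth_mktuple mxE. Qed.

Lemma tvec_tcons n (x : R) (w : T n) :
  tvec (tcons (x, w)) = col_mx x%:M (tvec w) :> 'cV_(1 + n).
Proof.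
apply/colP => i; rewrite -(splitK i); case: (fintype.split i) => j /=.
  rewrite col_mxEu !mxE (ord1 j) (_ : lshift n 0 = ord0) ?tnth0 ?eqxx//.
  exact/val_inj.
by rewrite col_mxEd !mxE (_ : rshift 1 j = lift ord0 j) ?tnthS//; exact/val_inj.
Qed.

Lemma vtup_col_mx n (u : 'cV[R]_1) (v : 'cV[R]_n) :
  vtup (col_mx u v : 'cV_n.+1) = tcons (u 0 0 : measurableTypeR R, vtup v).
Proof.
apply: (can_inj (@tvecK _)); rewrite vtupK tvec_tcons vtupK.
by rewrite /= {1}(mx11_scalar u).
Qed.

Definition mxact n (A : 'M[R]_n) (w : T n) : T n := vtup (A *m tvec w).

Lemma measurable_vtup d (X : measurableType d) n (F : X -> 'cV[R]_n) :
  (forall i, measurable_fun setT (fun x => F x i 0)) ->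
  measurable_fun setT (fun x => vtup (F x)).
Proof.
move=> mF; apply/measurable_fun_tnthP => i; apply: eq_measurable_fun (mF i).
by move=> x _; rewrite /= tnth_mktuple.
Qed.

Lemma measurable_tvec n i : measurable_fun setT (fun w : T n => tvec w i 0 : R).
Proof.
apply: eq_measurable_fun (measurable_tnth i) => w _.
by rewrite mxE.
Qed.

Lemma measurable_mxact n (A : 'M[R]_n) : measurable_fun setT (mxact A).
Proof.
apply: measurable_vtup => i; under eq_fun do rewrite mxE.
apply: measurable_sum => j; apply: measurable_funM => //.
exact: measurable_tvec.
Qed.

Local Open Scope ereal_scope.

Lemma lebesgue_tuple_tonelli1 n (f : T n.+1 -> \bar R) :
  measurable_fun setT f -> (forall w, 0 <= f w) ->
  \int[@lebesgue_tuple R n.+1]_w f w =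
  \int[@lebesgue_measure R]_x \int[@lebesgue_tuple R n]_w f (tcons (x, w)).
Proof.
move=> mf f0; rewrite [LHS](ge0_integral_pushforward (@measurable_tcons R n)
  (product_measure1 (@lebesgue_measure R) (@lebesgue_tuple R n)))//=.
rewrite preimage_setT -(fubini_tonelli1 (f \o @tcons R n))//.
  by apply: measurableT_comp => //; exact: measurable_tcons.
by move=> x; exact: f0.
Qed.

(** The order needed for upper shears, which move the first coordinate by a function of the
    others. *)
Lemma lebesgue_tuple_tonelli2 n (f : T n.+1 -> \bar R) :
  measurable_fun setT f -> (forall w, 0 <= f w) ->
  \int[@lebesgue_tuple R n.+1]_w f w =
  \int[@lebesgue_tuple R n]_w \int[@lebesgue_measure R]_x f (tcons (x, w)).
Proof.
move=> mf f0; rewrite lebesgue_tuple_tonelli1//.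
rewrite (fubini_tonelli (f \o @tcons R n))//.
  by apply: measurableT_comp => //; exact: measurable_tcons.
by move=> x; exact: f0.
Qed.

Lemma measurable_tcons_integral n (f : T n.+1 -> \bar R) :
  measurable_fun setT f -> (forall w, 0 <= f w) ->
  measurable_fun setT
    (fun x => \int[@lebesgue_tuple R n]_w f (tcons (x, w))).
Proof.
move=> mf f0; apply: (measurable_fun_fubini_tonelli_F (f \o @tcons R n)).
  by apply: measurableT_comp => //; exact: measurable_tcons.
by move=> x; exact: f0.
Qed.

Lemma measurable_tconsl n (f : T n.+1 -> \bar R) x :
  measurable_fun setT f -> measurable_fun setT (fun w => f (tcons (x, w))).
Proof.
move=> mf; apply: measurableT_comp => //.
by apply: measurableT_comp; [exact: measurable_tcons|exact: measurable_fun_pair].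
Qed.

Lemma measurable_tconsr n (f : T n.+1 -> \bar R) w :
  measurable_fun setT f ->
  measurable_fun setT (fun x : measurableTypeR R => f (tcons (x, w))).
Proof.
move=> mf; apply: measurableT_comp => //.
by apply: measurableT_comp; [exact: measurable_tcons|exact: measurable_fun_pair].
Qed.

Lemma measurable_translate n (v : 'cV[R]_n) :
  measurable_fun setT (fun w => vtup (tvec w + v)%R).
Proof.
apply: measurable_vtup => i; under eq_fun do rewrite mxE.
by apply: measurable_funD => //; exact: measurable_tvec.
Qed.

(** Induction on the dimension: the affine case on the line, with slope 1, shifts the first
    coordinate and the induction hypothesis shifts the rest. *)
Lemma ge0_integral_translate n (v : 'cV[R]_n) (f : T n -> \bar R) :
  measurable_fun setT f -> (forall w, 0 <= f w) ->
  \int[@lebesgue_tuple R n]_w f (vtup (tvec w + v)%R) =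
  \int[@lebesgue_tuple R n]_w f w.
Proof.
elim: n v f => [|n IH] v f mf f0.
  by apply: eq_integral => w _; rewrite (tuple0 (vtup _)) (tuple0 w).
rewrite [RHS]lebesgue_tuple_tonelli1// lebesgue_tuple_tonelli1//; last first.
  by apply: measurableT_comp => //; exact: measurable_translate.
have [v1 [v2 ->]] : exists v1 v2, v = col_mx v1 v2 :> 'cV_(1 + n).
  by exists (usubmx (v : 'cV_(1 + n))), (dsubmx (v : 'cV_(1 + n))); rewrite vsubmxK.
rewrite -[RHS](@ge0_integral_affine _ 1%R (v1 0 0)%R)//; last 2 first.
- exact: measurable_tcons_integral.
- by move=> x; exact: integral_ge0.
rewrite normr1 mul1e; apply: eq_integral => x _.
rewrite -[RHS](IH v2)//; last exact: measurable_tconsl.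
apply: eq_integral => w _; rewrite tvec_tcons mul1r.
rewrite -[X in vtup X]/(col_mx x%:M (tvec w) + col_mx v1 v2 : 'cV_(1 + n))%R.
by rewrite add_col_mx vtup_col_mx !mxE/= mulr1n.
Qed.

(** The change of variables formula for [A]. Quantifying over nonnegative integrands instead of sets
    lets it pass through matrix products and iterated integrals. *)
Definition scales n (A : 'M[R]_n) := forall f : T n -> \bar R,
  measurable_fun setT f -> (forall w, 0 <= f w) ->
  `|\det A|%:E * \int[@lebesgue_tuple R n]_w f (mxact A w) =
  \int[@lebesgue_tuple R n]_w f w.

Arguments scales {n} A%_R.

Lemma scalesM n (A B : 'M[R]_n) : scales A -> scales B -> scales (A *m B).
Proof.
move=> sA sB f mf f0.
rewrite -[RHS]sA// -[X in _ = _ * X]sB//; last first.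
  by apply: measurableT_comp => //; exact: measurable_mxact.
rewrite muleA det_mulmx normrM EFinM; congr (_ * _).
by apply: eq_integral => w _; rewrite /mxact vtupK mulmxA.
Qed.

Lemma mxact_tcons n (a : 'M[R]_1) (l : 'rV[R]_n) (c : 'cV_n) (D : 'M[R]_n) x w :
  (mxact (block_mx a l c D : 'M[R]_n.+1) (tcons (x, w)) =
   tcons ((a 0 0 * x + (l *m tvec w) 0 0) : measurableTypeR R,
          vtup (c *m x%:M + D *m tvec w)))%R.
Proof.
rewrite /mxact tvec_tcons.
rewrite -[X in vtup X]/(block_mx a l c D *m col_mx x%:M (tvec w))%R.
rewrite mul_block_col vtup_col_mx.
by rewrite mxE mul_mx_scalar mxE mulrC.
Qed.

Lemma measurable_comp_mxact n (A : 'M[R]_n) (f : T n -> \bar R) :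
  measurable_fun setT f -> measurable_fun setT (fun w => f (mxact A w)).
Proof. by move=> mf; apply: measurableT_comp => //; exact: measurable_mxact. Qed.

(** With the first coordinate [x] frozen, a lower shear translates the others by [c *m x%:M]. *)
Lemma scales_lower n (c : 'cV[R]_n) : scales (block_mx 1%:M 0 c 1%:M : 'M[R]_n.+1).
Proof.
move=> f mf f0; rewrite (@det_lblock _ 1) !det1 mulr1 normr1 mul1e.
rewrite [RHS]lebesgue_tuple_tonelli1// lebesgue_tuple_tonelli1//; last first.
  exact: measurable_comp_mxact.
apply: eq_integral => x _.
rewrite -[RHS](ge0_integral_translate (c *m x%:M)%R)//; last first.
  exact: measurable_tconsl.
apply: eq_integral => w _; rewrite mxact_tcons mul0mx !mxE addr0 mul1r mul1mx.
by rewrite addrC.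
Qed.

(** With the other coordinates frozen, an upper shear translates the first one. *)
Lemma scales_upper n (l : 'rV[R]_n) : scales (block_mx 1%:M l 0 1%:M : 'M[R]_n.+1).
Proof.
move=> f mf f0; rewrite (@det_ublock _ 1) !det1 mulr1 normr1 mul1e.
rewrite [RHS]lebesgue_tuple_tonelli2// lebesgue_tuple_tonelli2//; last first.
  exact: measurable_comp_mxact.
apply: eq_integral => w _.
rewrite -[RHS](@ge0_integral_affine _ 1%R ((l *m tvec w) 0 0)%R)//; last first.
  exact: measurable_tconsr.
rewrite normr1 mul1e; apply: eq_integral => x _.
by rewrite mxact_tcons mul0mx add0r mul1mx tvecK mxE.
Qed.

Lemma scales_diag n (a : R) (D : 'M[R]_n) : a != 0%R -> scales D ->
  scales (@block_mx R 1 n 1 n a%:M 0 0 D).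
Proof.
move=> a0 sD f mf f0; rewrite (@det_ublock _ 1) det_scalar1 normrM EFinM.
rewrite [RHS]lebesgue_tuple_tonelli1// lebesgue_tuple_tonelli1//; last first.
  exact: measurable_comp_mxact.
rewrite -[RHS](@ge0_integral_affine _ a 0%R)//; last 2 first.
- exact: measurable_tcons_integral.
- by move=> x; exact: integral_ge0.
rewrite -muleA; congr (_ * _).
rewrite -ge0_integralZl//; last 2 first.
- exact: (measurable_tcons_integral (measurable_comp_mxact _ mf)).
- by move=> x _; exact: integral_ge0.
apply: eq_integral => x _; rewrite addr0.
rewrite -[RHS]sD//; last exact: measurable_tconsl.
congr (_ * _); apply: eq_integral => w _.
by rewrite mxact_tcons !mul0mx mxE eqxx mulr1n mxE addr0 add0r.
Qed.

(* If the top left entry is nonzero, the Schur complement factors A into a lower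
   shear, a block diagonal matrix and an upper shear; otherwise an upper shear
   first brings a nonzero entry of the first column to the top. *)
Lemma scales_unitmx n (A : 'M[R]_n) : A \in unitmx -> scales A.
Proof.
elim: n A => [|n IH] A uA.
  move=> f mf f0; rewrite det_mx00 normr1 mul1e.
  by apply: eq_integral => w _; rewrite (tuple0 (mxact _ _)) (tuple0 w).
have pivot (B : 'M[R]_(1 + n)) : (B 0 0 != 0)%R -> B \in unitmx ->
    scales (B : 'M[R]_n.+1).
  move=> B00 uB.
  have ulB : ulsubmx B = (B 0 0)%:M%R.
    by rewrite [LHS]mx11_scalar !mxE !lshift0.
  pose D := (drsubmx B - dlsubmx B *m ((B 0 0)^-1 *: ursubmx B))%R.
  have BE : B = (block_mx 1%:M 0 ((B 0 0)^-1 *: dlsubmx B) 1%:M *m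
     block_mx (B 0 0)%:M 0 0 D *m
     block_mx 1%:M ((B 0 0)^-1 *: ursubmx B) 0 1%:M)%R.
    rewrite !mulmx_block !(mulmx0, mul0mx, mulmx1, mul1mx, addr0, add0r).
    rewrite mul_mx_scalar mul_scalar_mx !scalerA !divff// !scale1r -ulB /D.
    rewrite addrC subrK.
    by rewrite submxK.
  rewrite BE; apply: (scalesM (scalesM _ _)).
  - exact: scales_lower.
  - apply: scales_diag => //; apply: IH.
    move: uB; rewrite BE !unitmx_mul => /andP[/andP[_]].
    by rewrite !unitmxE det_ublock unitrM => /andP[].
  - exact: scales_upper.
have [A00|] := eqVneq (A 0 0)%R 0%R; last by move=> A00; exact: pivot.
(* A vanishing first column would annihilate the determinant, by expansion along it. *)
have [i Ai] : exists i, (A i 0 != 0)%R.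
  apply/existsP; apply: contraLR uA; rewrite negb_exists => /forallP Ai.
  rewrite unitmxE (expand_det_col _ 0%R) big1 ?unitr0// => i _.
  by have /negPn/eqP -> := Ai i; rewrite mul0r.
have [j ij] : exists j, i = lift 0%R j.
  by have [j ->|i0] := unliftP 0%R i; [exists j|rewrite i0 A00 eqxx in Ai].
pose l : 'rV[R]_n := delta_mx 0%R j.
have lE b : (block_mx 1%:M (b *: l) 0 1%:M : 'M[R]_(1 + n))%R \in unitmx.
  by rewrite unitmxE det_ublock !det1 mulr1 unitr1.
(* The inner shear adds row [i] of [A] to its top row, so that the new top left entry is [A i 0];
   the outer shear undoes it. *)
have -> : A = ((block_mx 1%:M (- 1 *: l) 0 1%:M : 'M[R]_(1 + n)) *m
    ((block_mx 1%:M (1 *: l) 0 1%:M : 'M[R]_(1 + n)) *m (A : 'M[R]_(1 + n))))%R.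
  rewrite mulmxA mulmx_block !(mulmx0, mul0mx, mulmx1, mul1mx, addr0, add0r).
  by rewrite scaleN1r scale1r subrr -scalar_mx_block mul1mx.
apply: scalesM; first exact: scales_upper.
apply: pivot; last by rewrite unitmx_mul lE.
rewrite -[X in (_ *m X)%R](@submxK R 1 n 1 n) mulmx_block.
have -> : 0%R = lshift n 0%R :> 'I_(1 + n) by exact: val_inj.
rewrite block_mxEul !mul1mx scale1r !mxE (_ : lshift n 0%R = 0%R); last first.
  exact: val_inj.
rewrite A00 add0r (bigD1 j)//= big1 => [|k kj].
  rewrite addr0 !mxE !eqxx mul1r (_ : lshift n 0%R = 0%R); last exact: val_inj.
  by rewrite (_ : rshift 1 j = i)// ij; exact: val_inj.
by rewrite !mxE (negbTE kj) andbF mul0r.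
Qed.

End tuples.

(** * Euclidean geometry and integrals over balls *)

Section euclidean.
Variables (R : realType) (n : nat).
Implicit Types (u v w : 'cV[R]_n) (a t : R).

Lemma dotvE u v : dotv u v = (u^T *m v) 0 0.
Proof. by rewrite mxE; apply: eq_bigr => i _; rewrite mxE. Qed.

Lemma dotvC u v : dotv u v = dotv v u.
Proof. by apply: eq_bigr => i _; rewrite mulrC. Qed.

Lemma dotvDl u v w : dotv (u + v) w = dotv u w + dotv v w.
Proof. by rewrite !dotvE linearD mulmxDl mxE. Qed.

Lemma dotvZl a u w : dotv (a *: u) w = a * dotv u w.
Proof. by rewrite !dotvE linearZ -scalemxAl mxE. Qed.

Lemma dotvDr u v w : dotv w (u + v) = dotv w u + dotv w v.
Proof. by rewrite dotvC dotvDl !(dotvC w). Qed.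

Lemma dotvZr a u w : dotv w (a *: u) = a * dotv w u.
Proof. by rewrite dotvC dotvZl (dotvC w). Qed.

Lemma dotv0l u : dotv 0 u = 0.
Proof. by rewrite dotvE linear0 mul0mx mxE. Qed.

Lemma dotv_mulmxl (A : 'M[R]_n) u v : dotv (A *m u) v = dotv u (A^T *m v).
Proof. by rewrite !dotvE trmx_mul mulmxA. Qed.

Lemma dotv_deltal i u : dotv (delta_mx i 0) u = u i 0.
Proof.
rewrite /dotv (bigD1 i)//= big1 ?addr0 ?mxE ?eqxx ?mul1r//.
by move=> j ji; rewrite mxE (negbTE ji) mul0r.
Qed.

Lemma dotv_ge0 u : 0 <= dotv u u.
Proof. by apply: sumr_ge0 => i _; rewrite -expr2 sqr_ge0. Qed.

Lemma sqr_enorm u : enorm u ^+ 2 = dotv u u.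
Proof. by rewrite sqr_sqrtr// dotv_ge0. Qed.

Lemma enorm_ge0 u : 0 <= enorm u.
Proof. exact: sqrtr_ge0. Qed.

Lemma enorm_eq0 u : (enorm u == 0) = (u == 0).
Proof.
have -> : (enorm u == 0) = (dotv u u == 0) by rewrite -sqr_enorm expf_eq0.
apply/eqP/eqP => [|->]; last exact: dotv0l.
move/eqP; rewrite psumr_eq0 => [/allP u0|i _]; last by rewrite -expr2 sqr_ge0.
apply/colP => i; rewrite mxE; apply/eqP; rewrite -[_ == _]orbb -mulf_eq0.
exact: u0 (mem_index_enum i).
Qed.

Lemma enormZ t u : 0 <= t -> enorm (t *: u) = t * enorm u.
Proof.
move=> t0; rewrite /enorm dotvZl dotvZr mulrA sqrtrM -?expr2 ?sqr_ge0//.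
by rewrite sqrtr_sqr ger0_norm.
Qed.

Lemma enorm_delta i : enorm (delta_mx i 0 : 'cV[R]_n) = 1.
Proof. by rewrite /enorm dotv_deltal mxE !eqxx sqrtr1. Qed.

Lemma cauchy_schwarz u v : `|dotv u v| <= enorm u * enorm v.
Proof.
have [->|v0] := eqVneq v 0.
  by rewrite dotvC dotv0l normr0 mulr_ge0// enorm_ge0.
rewrite -(@ler_pXn2r _ 2)// ?nnegrE ?mulr_ge0 ?enorm_ge0//.
rewrite real_normK ?num_real// exprMn !sqr_enorm.
have b0 : 0 < dotv v v.
  by rewrite -sqr_enorm exprn_gt0// lt_def enorm_eq0 v0 enorm_ge0.
(* The square of this vector is [dotv v v] times the difference of the two sides of the goal. *)
have := dotv_ge0 (dotv v v *: u + (- dotv u v) *: v).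
rewrite !(dotvDl, dotvDr, dotvZl, dotvZr) (dotvC v u) => h.
rewrite -subr_ge0 -(pmulr_rge0 _ b0); apply: le_trans h _.
by rewrite le_eqVlt; apply/orP; left; apply/eqP; ring.
Qed.

Lemma ler_coord_enorm u i : `|u i 0| <= enorm u.
Proof.
by rewrite -dotv_deltal (le_trans (cauchy_schwarz _ _))// enorm_delta mul1r.
Qed.

(** The [n] squares sum to less than t^2 / n, which is at most t^2. This places a cube inside the
    ball. *)
Lemma enorm_lt_coord u t : (0 < n)%N -> (forall i, `|u i 0| < t / n%:R) ->
  enorm u < t.
Proof.
move=> n0 ut; have n0' : 0 < n%:R :> R by rewrite ltr0n.
have t0 : 0 < t.
  have := le_lt_trans (normr_ge0 _) (ut (Ordinal n0)).
  by rewrite pmulr_lgt0// invr_gt0.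
rewrite -(@ltr_pXn2r _ 2)// ?nnegrE ?enorm_ge0 ?(ltW t0)// sqr_enorm.
apply: (@lt_le_trans _ _ (\sum_(i < n) (t / n%:R) ^+ 2)).
  apply: ltr_sum; first by apply/hasP; exists (Ordinal n0); rewrite ?mem_index_enum.
  move=> i _; rewrite -expr2 -real_normK ?num_real//.
  by rewrite ltr_pXn2r// ?nnegrE// ltW// (le_lt_trans (normr_ge0 _) (ut i)).
rewrite sumr_const card_ord -[X in X <= _]mulr_natr exprMn -mulrA.
rewrite (ger_pMr _ (exprn_gt0 2 t0)).
rewrite expr2 -mulrA mulVf ?gt_eqF// mulr1.
by rewrite invf_le1// ler1n.
Qed.

(** For distinct [u] and [v], the Householder reflection in the hyperplane orthogonal to [u - v]
    exchanges them. *)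
Lemma orthogonal_mx_exists u v : enorm u = enorm v ->
  exists2 Q : 'M[R]_n, Q^T *m Q = 1%:M & Q *m u = v.
Proof.
move=> uv; have [<-|nuv] := eqVneq u v.
  by exists 1%:M; rewrite ?trmx1 mul1mx.
pose d := u - v; have d0 : dotv d d != 0.
  by rewrite -sqr_enorm expf_eq0/= enorm_eq0 subr_eq0.
pose H : 'M[R]_n := 1%:M - (2 / dotv d d) *: (d *m d^T).
have HT : H^T = H.
  by rewrite /H linearB linearZ/= trmx_mul trmxK trmx1.
have Hw w : H *m w = w - (2 * dotv d w / dotv d d) *: d.
  rewrite /H mulmxBl mul1mx -scalemxAl -mulmxA [d^T *m w]mx11_scalar -dotvE.
  by rewrite mul_mx_scalar scalerA mulrAC.
exists H.
  rewrite HT {2}/H mulmxBr mulmx1 -scalemxAr mulmxA Hw.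
  have -> : 2 * dotv d d / dotv d d = 2 by rewrite mulfK.
  rewrite -[X in X *m d^T]/(_ - _) scaler_nat mulr2n opprD addrA subrr sub0r mulNmx.
  by rewrite scalerN /H opprK subrK.
rewrite Hw.
(* Equality of the norms enters here: the reflection then subtracts exactly [d] from [u]. *)
have -> : 2 * dotv d u = dotv d d.
  have dE : dotv u u = dotv v v by rewrite -!sqr_enorm uv.
  rewrite /d -[- v]scaleN1r !(dotvDl, dotvDr, dotvZl, dotvZr).
  rewrite dE (dotvC v u).
  by ring.
by rewrite divff// scale1r /d opprB addrC subrK.
Qed.

End euclidean.

Section measurability.
Variables (R : realType) (n : nat).
Local Notation T := (n.-tuple (measurableTypeR R)).

Lemma measurable_dotv d (X : measurableType d) (u : 'cV[R]_n) (F : X -> T) :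
  measurable_fun setT F -> measurable_fun setT (fun x => dotv u (tvec (F x))).
Proof.
move=> mF; apply: measurable_sum => i; apply: measurable_funM => //.
by apply: (measurableT_comp (@measurable_tvec R n i)).
Qed.

Lemma measurable_enorm : measurable_fun setT (fun w : T => enorm (tvec w)).
Proof.
apply: (measurableT_comp (continuous_measurable_fun _)).
  exact: sqrt_continuous.
apply: measurable_sum => i; apply: measurable_funM; exact: measurable_tvec.
Qed.

Definition eball (delta : R) : set T := [set w | enorm (tvec w) < delta].

Lemma measurable_eball delta : measurable (eball delta).
Proof.
rewrite -[X in measurable X]setTI.
exact: (measurable_fun_ltr measurable_enorm
  (@measurable_cst _ _ _ _ _ delta)) measurableT [set true] _.
Qed.

End measurability.

Section change_of_variables.
Variables (R : realType) (n : nat).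
Local Notation T := (n.-tuple (measurableTypeR R)).
Local Notation mu := (@lebesgue_tuple R n).

Lemma ge0_integral_mxact (A : 'M[R]_n) (D : set T) (f : T -> \bar R) :
  A \in unitmx -> measurable D -> measurable_fun setT f ->
  (forall w, 0 <= f w)%E ->
  (`|\det A|%:E * \int[mu]_(w in mxact A @^-1` D) f (mxact A w) =
   \int[mu]_(w in D) f w)%E.
Proof.
move=> uA mD mf f0; rewrite [RHS]integral_mkcond [in LHS]integral_mkcond.
rewrite -(scales_unitmx uA (f := f \_ D)); last 2 first.
- by apply/(measurable_restrictT f) => //; exact: measurable_funTS.
- by move=> w; rewrite patchE; case: ifP.
by congr (_ * _)%E; apply: eq_integral => w _; rewrite !patchE.
Qed.

(** The nonnegative case applies to the positive and the negative part separately, as an equality of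
    extended reals. *)
Lemma Rintegral_mxact (A : 'M[R]_n) (D : set T) (f : T -> R) :
  `|\det A| = 1 -> measurable D -> measurable_fun setT f ->
  \int[mu]_(w in mxact A @^-1` D) f (mxact A w) = \int[mu]_(w in D) f w.
Proof.
move=> A1 mD mf; have uA : A \in unitmx.
  by rewrite unitmxE unitfE -normr_eq0 A1 oner_eq0.
have mEf : measurable_fun setT (EFin \o f) by exact/measurable_EFinP.
rewrite /Rintegral; congr fine; rewrite integralE [RHS]integralE.
congr (_ - _)%E.
  rewrite -(ge0_integral_mxact uA mD (measurable_funepos mEf)) ?A1 ?mul1e//.
  by apply: eq_integral => w _; rewrite funeposE/= funeposE.
rewrite -(ge0_integral_mxact uA mD (measurable_funeneg mEf)) ?A1 ?mul1e//.
by apply: eq_integral => w _; rewrite funenegE/= funenegE.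
Qed.

End change_of_variables.

(** * Calculus of integrals over a ball *)

Section ball_integral.
Variables (R : realType) (n : nat) (delta : R).
Local Notation T := (n.-tuple (measurableTypeR R)).
Local Notation mu := (@lebesgue_tuple R n).
Implicit Types (f g : 'cV[R]_n -> R).

Definition measurable_vec f := measurable_fun setT (fun w : T => f (tvec w)).

Definition ball_integrable f :=
  mu.-integrable (@eball R n delta) (fun w => (f (tvec w))%:E).

(** An orthogonal matrix has determinant of absolute value 1 and preserves the norm, so the ball is
    its own preimage. *)
Lemma ball_int_orthogonal (Q : 'M[R]_n) f : Q^T *m Q = 1%:M ->
  measurable_vec f -> ball_int delta (fun w => f (Q *m w)) = ball_int delta f.
Proof.
move=> QQ mf.
have detQ : `|\det Q| = 1.
  have := congr1 determinant QQ; rewrite det_mulmx det_tr det1 -expr2.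
  by move/eqP; rewrite -[_ ^+ 2]real_normK ?num_real// sqrp_eq1// => /eqP.
rewrite /ball_int -[RHS](Rintegral_mxact detQ)//; last exact: measurable_eball.
have -> : mxact Q @^-1` @eball R n delta = @eball R n delta.
  apply/seteqP; split => w;
    by rewrite /eball/= /mxact vtupK /enorm dotv_mulmxl mulmxA QQ mul1mx.
by apply: eq_Rintegral => w _; rewrite /mxact vtupK.
Qed.

Lemma eq_ball_int f g : (forall w, f w = g w) ->
  ball_int delta f = ball_int delta g.
Proof. by move=> fg; apply: eq_Rintegral => w _; exact: fg. Qed.

Lemma ball_intZ k f : ball_integrable f ->
  ball_int delta (fun w => k * f w) = k * ball_int delta f.
Proof. by move=> fi; rewrite /ball_int RintegralZl//; exact: measurable_eball. Qed.

Lemma ball_integrableZ k f : ball_integrable f ->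
  ball_integrable (fun w => k * f w).
Proof.
move=> fi; have := integrableZl (@measurable_eball R n delta) k fi.
by apply: eq_integrable; [exact: measurable_eball|move=> w _; rewrite EFinM].
Qed.

Lemma ball_integrable_sum (I : Type) (s : seq I) (F : I -> 'cV[R]_n -> R) :
  (forall i, ball_integrable (F i)) ->
  ball_integrable (fun w => \sum_(i <- s) F i w).
Proof.
move=> Fi; have := integrable_sum (@measurable_eball R n delta) s
  (fun i (_ : xpredT i) => Fi i).
apply: eq_integrable; first exact: measurable_eball.
by move=> w _; rewrite sumEFin.
Qed.

Lemma ball_int_sum (I : Type) (s : seq I) (F : I -> 'cV[R]_n -> R) :
  (forall i, ball_integrable (F i)) ->
  ball_int delta (fun w => \sum_(i <- s) F i w) =
  \sum_(i <- s) ball_int delta (F i).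
Proof.
move=> Fi; elim: s => [|i s IH].
  rewrite big_nil (@eq_ball_int _ (fun=> 0)) => [|w]; last by rewrite big_nil.
  by rewrite /ball_int /Rintegral integral0.
rewrite big_cons -IH /ball_int -RintegralD//; last 3 first.
- exact: measurable_eball.
- exact: Fi.
- exact: ball_integrable_sum.
by apply: eq_Rintegral => w _; rewrite big_cons.
Qed.

Lemma ball_integrable_le f g : measurable_vec f ->
  ball_integrable g -> (forall w, enorm w < delta -> `|f w| <= g w) ->
  ball_integrable f.
Proof.
move=> mf gi fg; apply: le_integrable gi => //; first exact: measurable_eball.
  exact/measurable_EFinP/measurable_funTS.
by move=> w Dw; rewrite /= lee_fin (le_trans (fg _ Dw))// ler_norm.
Qed.

End ball_integral.

(** * Homogeneity of powers of the norm and the measure of balls *)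

Section radial.
Variables (R : realType) (n : nat).
Local Notation T := (n.-tuple (measurableTypeR R)).
Local Notation mu := (@lebesgue_tuple R n).
Implicit Types (gam delta q t : R) (w : 'cV[R]_n).

(* The integrand of cdb, equal to |w|^(2 - gam) for w != 0. It vanishes at the
   origin for every gam, so that no pointwise identity below has an exception. *)
Definition radial gam w := enorm w ^+ 2 / enorm w `^ gam.

Lemma radial_ge0 gam w : 0 <= radial gam w.
Proof. by rewrite /radial divr_ge0 ?powR_ge0// exprn_ge0// enorm_ge0. Qed.

Lemma radial0 gam : radial gam 0 = 0.
Proof.
rewrite /radial (_ : enorm 0 = 0) ?expr0n/= ?mul0r//.
by apply/eqP; rewrite enorm_eq0.
Qed.

Lemma radialE gam w : w != 0 -> radial gam w = enorm w `^ (2 - gam).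
Proof.
move=> w0; rewrite powRB ?enorm_eq0 ?w0 ?implybT// powR_mulrn//.
exact: enorm_ge0.
Qed.

Lemma radialZ gam t w : 0 < t -> radial gam (t *: w) = t `^ (2 - gam) * radial gam w.
Proof.
move=> t0; have [->|w0] := eqVneq w 0; first by rewrite scaler0 radial0 mulr0.
rewrite !radialE ?scaler_eq0 ?negb_or ?(gt_eqF t0)// enormZ ?(ltW t0)//.
by rewrite powRM ?(ltW t0)// enorm_ge0.
Qed.

Lemma measurable_radial gam : measurable_vec (@radial gam).
Proof.
apply: measurable_funM.
  by apply: measurable_funX; exact: measurable_enorm.
under eq_fun do rewrite -powRN.
by apply: (measurableT_comp (measurable_powR _)); exact: measurable_enorm.
Qed.

Let mER gam : measurable_fun setT (fun w : T => (radial gam (tvec w))%:E).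
Proof. by apply/measurable_EFinP; exact: measurable_radial. Qed.

Lemma mxact_scalar t (w : T) : mxact t%:M w = vtup (t *: tvec w).
Proof. by rewrite /mxact mul_scalar_mx. Qed.

Lemma lebesgue_tuple_scale t (D : set T) : 0 < t -> measurable D ->
  mu D = ((t ^+ n)%:E * mu (mxact t%:M @^-1` D))%E.
Proof.
move=> t0 mD; have ut : (t%:M : 'M[R]_n) \in unitmx.
  by rewrite unitmxE det_scalar unitrX// unitfE gt_eqF.
have := ge0_integral_mxact ut mD (measurable_cst 1%E) (fun=> lee01).
rewrite !integral_cst ?mul1e// ?det_scalar ?normrX ?gtr0_norm//.
by rewrite -[X in measurable X]setTI; exact: measurable_mxact.
Qed.

(** The exponent adds the [n] of the Jacobian to the degree [2 - gam] of the integrand. *)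
Lemma integral_radial_scale t gam (D : set T) : 0 < t -> measurable D ->
  (\int[mu]_(w in D) (radial gam (tvec w))%:E =
  (t `^ (n%:R + 2 - gam))%:E *
    \int[mu]_(w in mxact t%:M @^-1` D) (radial gam (tvec w))%:E)%E.
Proof.
move=> t0 mD; have ut : (t%:M : 'M[R]_n) \in unitmx.
  by rewrite unitmxE det_scalar unitrX// unitfE gt_eqF.
rewrite -(ge0_integral_mxact ut mD (@mER gam)); last first.
  by move=> w; rewrite lee_fin radial_ge0.
under eq_integral do rewrite mxact_scalar vtupK radialZ// EFinM.
have mpD : measurable (mxact t%:M @^-1` D).
  by rewrite -[X in measurable X]setTI; exact: measurable_mxact.
rewrite ge0_integralZl//; last 3 first.
- exact: measurable_funTS.
- by move=> w _; rewrite lee_fin radial_ge0.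
- by rewrite lee_fin powR_ge0.
rewrite muleA -EFinM det_scalar normrX gtr0_norm// -powR_mulrn ?(ltW t0)//.
by rewrite -powRD ?addrA// (gt_eqF t0) implybT.
Qed.

Lemma eball_scale t delta : 0 < t ->
  mxact t%:M @^-1` (@eball R n (t * delta)) = @eball R n delta.
Proof.
move=> t0; apply/seteqP; split => w;
  by rewrite /eball/= mxact_scalar vtupK enormZ ?(ltW t0)// ltr_pM2l.
Qed.

Lemma measurable_cube (I : set (measurableTypeR R)) : measurable I ->
  measurable [set w : T | forall i, I (tnth w i)].
Proof.
move=> mI; rewrite (_ : mkset _ = \bigcap_(i : 'I_n) (@tnth n _ ^~ i @^-1` I)).
  apply: fin_bigcap_measurable => // i _.
  by rewrite -[X in measurable X]setTI; exact: measurable_tnth.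
by apply/seteqP; split => w /= h i; [move=> _; exact: h|exact: h].
Qed.

(** The ball lies in the cube of half-side [delta]. *)
Lemma eball_fin_num delta : 0 < delta -> mu (@eball R n delta) \is a fin_num.
Proof.
move=> d0; rewrite ge0_fin_numE//.
pose I : set (measurableTypeR R) := [set x | x \in `[- delta, delta]].
have mI : measurable I by exact: measurable_itv.
apply: (@le_lt_trans _ _ (mu [set w | forall i : 'I_n, I (tnth w i)])).
  apply: le_measure; rewrite ?inE//; first exact: measurable_eball.
    exact: measurable_cube.
  move=> w wd i; rewrite /I/= in_itv/= -ler_norml.
  by have := le_lt_trans (ler_coord_enorm (tvec w) i) wd; rewrite mxE => /ltW.
rewrite (@lebesgue_tuple_box R n (fun=> I))//.
by rewrite lebesgue_measure_itv/= lte_fin gtrN// -EFinB prodEFin ltry.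
Qed.

(** The ball contains the open cube of half-side [delta / n%:R]. *)
Lemma eball_gt0 delta : (0 < n)%N -> 0 < delta -> (0 < mu (@eball R n delta))%E.
Proof.
move=> n0 d0.
pose e := delta / n%:R.
have e0 : 0 < e by rewrite divr_gt0// ltr0n.
pose I : set (measurableTypeR R) := [set x | x \in `]- e, e[].
have mI : measurable I by exact: measurable_itv.
apply: (@lt_le_trans _ _ (mu [set w | forall i : 'I_n, I (tnth w i)])).
  rewrite (@lebesgue_tuple_box R n (fun=> I))//.
  rewrite lebesgue_measure_itv/= lte_fin gtrN// -EFinB prodEFin lte_fin.
  by apply: prodr_gt0 => i _; rewrite opprK addr_gt0.
apply: le_measure; rewrite ?inE//; last first.
  move=> w wI; apply: enorm_lt_coord => // i.
  by have := wI i; rewrite /I/= in_itv/= -ltr_norml mxE.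
  exact: measurable_eball.
exact: measurable_cube.
Qed.

End radial.

(** * Integrals of powers of the norm *)

Section radial_integral.
Variables (R : realType) (n : nat).
Local Notation T := (n.-tuple (measurableTypeR R)).
Local Notation mu := (@lebesgue_tuple R n).
Implicit Types (gam delta q t : R).

Let mER gam : measurable_fun setT (fun w : T => (radial gam (tvec w))%:E).
Proof. by apply/measurable_EFinP; exact: measurable_radial. Qed.

Let rad_ge0 gam (w : T) : (0 <= (radial gam (tvec w))%:E)%E.
Proof. by rewrite lee_fin radial_ge0. Qed.

(** Using the absolute value of [p] covers both signs of the exponent at once, and both bounds tend
    to 1 with [q]. *)
Lemma powR_norm_bounds q s (p : R) : 0 < q -> q <= s <= 1 ->
  q `^ `|p| <= s `^ p <= q `^ (- `|p|).
Proof.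
move=> q0 /andP[qs s1]; have s0 : 0 < s by exact: lt_le_trans qs.
have h : q `^ `|p| <= s `^ `|p|.
  by apply: ge0_ler_powR; rewrite ?nnegrE ?normr_ge0// ltW.
apply/andP; split.
  by apply: (le_trans h); apply: ger_powR; rewrite ?s0// ler_norm.
apply: (@le_trans _ _ (s `^ (- `|p|))).
  by apply: ger_powR; rewrite ?s0// lerNl -normrN ler_norm.
by rewrite !powRN lef_pV2 ?posrE ?powR_gt0.
Qed.

Lemma radial_shell_bounds gam delta q (w : 'cV[R]_n) : 0 < delta -> 0 < q < 1 ->
  q * delta <= enorm w <= delta ->
  delta `^ (2 - gam) * q `^ `|2 - gam| <= radial gam w
    <= delta `^ (2 - gam) * q `^ (- `|2 - gam|).
Proof.
move=> d0 /andP[q0 q1] /andP[qw wd].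
have w0 : 0 < enorm w by apply: lt_le_trans qw; rewrite mulr_gt0.
rewrite radialE; last by rewrite -enorm_eq0 gt_eqF.
have -> : enorm w = delta * (enorm w / delta) by rewrite mulrC divfK ?gt_eqF.
rewrite powRM ?(ltW d0)//; last by rewrite divr_ge0 ?(ltW w0)// ltW.
rewrite !ler_pM2l ?powR_gt0//; apply: powR_norm_bounds => //.
by rewrite ler_pdivlMr// qw ler_pdivrMr// mul1r.
Qed.

Let shell delta q : set T := eball delta `\` eball (q * delta).

Let mshell delta q : measurable (shell delta q).
Proof. by apply: measurableD; exact: measurable_eball. Qed.

Let subshell delta q : 0 < delta -> 0 < q < 1 ->
  eball (q * delta) `<=` @eball R n delta.
Proof.
move=> d0 /andP[q0 q1] w; rewrite /eball/= => h; apply: lt_le_trans h _.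
by rewrite ler_piMl ?ltW.
Qed.

Let V delta := fine (mu (eball delta)).

Let muV delta : 0 < delta -> mu (eball delta) = (V delta)%:E.
Proof. by move=> d0; rewrite /V fineK// eball_fin_num. Qed.

Let mu_shell delta q : 0 < delta -> 0 < q < 1 ->
  mu (shell delta q) = ((1 - q ^+ n) * V delta)%:E.
Proof.
move=> d0 q01; have q0 : 0 < q by case/andP: q01.
have qd0 : 0 < q * delta by rewrite mulr_gt0.
have -> : mu (shell delta q) = (mu (eball delta) - mu (eball (q * delta)))%E.
  rewrite measureD; [|exact: measurable_eball|exact: measurable_eball|]; last first.
    by rewrite -ge0_fin_numE//; exact: eball_fin_num.
  by rewrite (setIidr (subshell d0 q01)).
rewrite [mu (eball (q * _))](lebesgue_tuple_scale q0); last exact: measurable_eball.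
by rewrite eball_scale// muV// -EFinM -EFinB mulrBl mul1r.
Qed.

Let int_shell_bounds gam delta q : 0 < delta -> 0 < q < 1 ->
  ((delta `^ (2 - gam) * q `^ `|2 - gam| * ((1 - q ^+ n) * V delta))%:E
    <= \int[mu]_(w in shell delta q) (radial gam (tvec w))%:E
    <= (delta `^ (2 - gam) * q `^ (- `|2 - gam|) * ((1 - q ^+ n) * V delta))%:E)%E.
Proof.
move=> d0 q01; rewrite 2!(EFinM _ (_ * V delta)) -mu_shell//.
rewrite -!integral_cst//; apply/andP; split; apply: ge0_le_integral => //.
- by move=> w _; rewrite lee_fin mulr_ge0 ?powR_ge0.
- exact: measurable_funTS.
- move=> w [w1 /negP]; rewrite -leNgt => w2; rewrite lee_fin.
  by have /andP[] := radial_shell_bounds gam d0 q01 (introT andP (conj w2 (ltW w1))).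
- exact: measurable_funTS.
- move=> w [w1 /negP]; rewrite -leNgt => w2; rewrite lee_fin.
  by have /andP[] := radial_shell_bounds gam d0 q01 (introT andP (conj w2 (ltW w1))).
Qed.

(* By homogeneity the integrals E_k over delta q^k <= |w| < delta satisfy
   E_(k+1) = S + r E_k with r = q^(n+2-gam) < 1, whence E_k <= S / (1 - r). *)
Lemma radial_integral_lty gam delta : 0 < delta -> gam < n%:R + 2 ->
  (\int[mu]_(w in eball delta) (radial gam (tvec w))%:E < +oo)%E.
Proof.
move=> d0 g2; pose q : R := 2^-1.
have q01 : 0 < q < 1 by rewrite /q; lra.
have q0 : 0 < q by case/andP: q01.
pose D k : set T := eball delta `\` eball (q ^+ k * delta).
have mD k : measurable (D k) by apply: measurableD; exact: measurable_eball.
pose r := q `^ (n%:R + 2 - gam).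
have r1 : r < 1.
  rewrite /r -[X in _ < X](powRr0 q) /powR gt_eqF// ltr_expR.
  by rewrite mul0r nmulr_llt0 ?subr_gt0// ln_lt0.
pose S := (\int[mu]_(w in shell delta q) (radial gam (tvec w))%:E)%E.
have Sfin : S \is a fin_num.
  rewrite ge0_fin_numE ?integral_ge0//.
  have /andP[_ h] := int_shell_bounds gam d0 q01.
  by apply: le_lt_trans h _; rewrite ltry.
have DS k : D k.+1 =
    shell delta q `|` (eball (q * delta) `\` eball (q ^+ k.+1 * delta)).
  apply/seteqP; split=> w; rewrite /D /shell /eball /=.
    move=> [w1 w2]; have [w3|w3] := ltP (enorm (tvec w)) (q * delta).
      by right.
    by left; split=> //; rewrite -leNgt.
  move=> [[w1 w2]|[w1 w2]]; split => //.
    move=> w3; apply: w2; apply: lt_le_trans w3 _; rewrite ler_pM2r// exprS.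
    by rewrite ler_piMr ?(ltW q0)// exprn_ile1 ?(ltW q0)//; case/andP: q01 => _ /ltW.
  exact: (@subshell delta q).
have DE k : (\int[mu]_(w in D k.+1) (radial gam (tvec w))%:E =
    S + r%:E * \int[mu]_(w in D k) (radial gam (tvec w))%:E)%E.
  have mqD : measurable (eball (q * delta) `\` eball (q ^+ k.+1 * delta) : set T).
    by apply: measurableD; exact: measurable_eball.
  rewrite DS ge0_integral_setU//; last 2 first.
  - exact: measurable_funTS.
  - by apply/disj_setPS => w /= [[_ w1] [w2 _]]; apply: w1.
  (* The part inside radius [q * delta] is [D k] dilated by [q]. *)
  congr (_ + _)%E; rewrite (integral_radial_scale gam q0 mqD).
  rewrite (_ : _ @^-1` _ = D k)//.
  rewrite /D -(eball_scale n delta q0) -(eball_scale n (q ^+ k * delta) q0).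
  by rewrite mulrA -exprS.
have Dle k : (\int[mu]_(w in D k) (radial gam (tvec w))%:E <= S * ((1 - r)^-1)%:E)%E.
  have r0 : 0 <= r by exact: powR_ge0.
  have S0 : 0 <= fine S by rewrite fine_ge0// integral_ge0.
  elim: k => [|k IH].
    rewrite /D expr0 mul1r setDv integral_set0 mule_ge0 ?integral_ge0//.
    by rewrite lee_fin invr_ge0 subr_ge0 ltW.
  rewrite DE; apply: (@le_trans _ _ (S + r%:E * (S * (1 - r)^-1%:E))%E).
    by rewrite leeD2l// lee_wpmul2l// lee_fin.
  (* S / (1 - r) is the fixed point of E -> S + r E, so the induction closes with an equality. *)
  rewrite -(fineK Sfin) -!EFinM -EFinD lee_fin le_eqVlt; apply/orP; left.
  by apply/eqP; field; rewrite subr_eq0 gt_eqF.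
(* The sets [D k] exhaust the ball except for the origin, where [radial] vanishes. *)
have DU : (\int[mu]_(w in eball delta) (radial gam (tvec w))%:E =
           \int[mu]_(w in \bigcup_k D k) (radial gam (tvec w))%:E)%E.
  rewrite integral_mkcond [RHS]integral_mkcond; apply: eq_integral => w _.
  rewrite !patchE; have [w0|w0] := eqVneq (tvec w) 0.
    by rewrite w0 radial0 !if_same.
  rewrite (_ : (w \in eball delta) = (w \in \bigcup_k D k))//.
  apply/idP/idP; rewrite !inE; last by case=> k _ [].
  move=> wd.
  have wgt0 : 0 < enorm (tvec w) by rewrite lt_def enorm_eq0 w0 enorm_ge0.
  have qn : `|q| < 1 by rewrite gtr0_norm//; case/andP: q01.
  have [k kw] := filter_ex (cvgr_lt _ (cvg_geometric delta qn) _ wgt0).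
  move: kw; rewrite /geometric/= mulrC => kw.
  exists k => //; split => //; rewrite /eball/= => /lt_trans/(_ kw).
  by rewrite ltxx.
rewrite DU; apply: (@le_lt_trans _ _ (S * ((1 - r)^-1)%:E)%E); last first.
  by rewrite -(fineK Sfin) -EFinM ltry.
have Dnd : {homo D : i j / (i <= j)%N >-> (i <= j)%O}.
  move=> i j ij; apply/subsetPset => w [w1 w2]; split => // w3; apply: w2.
  apply: lt_le_trans w3 _; rewrite ler_pM2r// ler_wiXn2l// ltW//.
  by case/andP: q01.
apply: cvge_to_le (ge0_nondecreasing_set_cvg_integral (mu := mu) Dnd mD _ _) _.
- by move=> i; exact: measurable_funTS.
- by [].
- exact: nearW.
Qed.

(** The quotient is the slope of x^c between [h + 1] and 1, hence tends to the derivative at 1.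
    Approaching from the left keeps the ratio [h + 1] of the radii below 1. *)
Lemma powR_slope_cvg (c : R) :
  (1 - (h + 1) `^ c) / (1 - (h + 1)) @[h --> 0^'-] --> c.
Proof.
apply: cvg_dnbhs_at_left.
have [df dE] := is_derive1_powR c (@ltr01 R).
have : h^-1 *: (((@powR R ^~ c) \o shift 1) (h *: 1) - 1 `^ c) @[h --> 0^']
    --> 'D_1 (@powR R ^~ c) 1 := df.
rewrite dE powR1 mulr1.
apply: cvg_trans; apply: near_eq_cvg; near=> h.
rewrite /= [h *: 1]mulr1 opprD addrCA subrr addr0.
by rewrite invrN mulrN -mulNr opprB mulrC.
Unshelve. all: by end_near. Qed.

(** Continuity is read off the slope: x^c is 1 minus [1 - x] times the slope. *)
Lemma powR_near1_cvg (c : R) : (h + 1) `^ c @[h --> 0^'-] --> (1 : R).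
Proof.
have : 1 - (1 - (h + 1)) * ((1 - (h + 1) `^ c) / (1 - (h + 1))) @[h --> (0:R)^'-]
    --> 1 - (1 - (0 + 1)) * c.
  apply: cvgB; first exact: cvg_cst.
  apply: cvgM; last exact: powR_slope_cvg.
  apply: cvgB; first exact: cvg_cst.
  apply: cvgD; last exact: cvg_cst.
  exact/cvg_at_left_filter/cvg_id.
rewrite [X in _ --> X](_ : _ = 1); last by rewrite add0r subrr mul0r subr0.
apply: cvg_trans; apply: near_eq_cvg; near=> h.
have h0 : h < 0 by near: h; exact: nbhs_left_lt.
have h1 : 1 - (h + 1) != 0 by rewrite opprD addrCA subrr addr0 oppr_eq0 lt_eqF.
by rewrite [X in 1 - X](mulrC (1 - (h + 1))) divfK// subKr.
Unshelve. all: by end_near. Qed.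

(* Homogeneity expresses the integral over the shell q delta <= |w| < delta as
   (1 - q^(n+2-gam)) times the integral over the ball, while on a thin shell the
   integrand is nearly constant: divide by 1 - q and let q tend to 1. *)
Lemma ball_int_radial gam delta : 0 < delta -> gam < n%:R + 2 ->
  ball_int delta (@radial R n gam) * (n%:R + 2 - gam) =
  delta `^ (2 - gam) * (n%:R * fine (mu (eball delta))).
Proof.
move=> d0 g2; rewrite -/(V delta).
set rho := ball_int _ _.
have Efin : (\int[mu]_(w in eball delta) (radial gam (tvec w))%:E)%E \is a fin_num.
  by rewrite ge0_fin_numE ?integral_ge0// radial_integral_lty.
have EE : (\int[mu]_(w in eball delta) (radial gam (tvec w))%:E = rho%:E)%E.
  by rewrite /rho/ball_int/Rintegral fineK.
have shE q : 0 < q < 1 -> (\int[mu]_(w in shell delta q) (radial gam (tvec w))%:E =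
    ((1 - q `^ (n%:R + 2 - gam)) * rho)%:E)%E.
  move=> q01; have q0 : 0 < q by case/andP: q01.
  have : (\int[mu]_(w in eball delta) (radial gam (tvec w))%:E =
     \int[mu]_(w in shell delta q) (radial gam (tvec w))%:E +
     (q `^ (n%:R + 2 - gam))%:E *
       \int[mu]_(w in eball delta) (radial gam (tvec w))%:E)%E.
    rewrite -[X in _ = (_ + _ * \int[_]_(_ in X) _)%E](eball_scale n delta q0).
    rewrite -integral_radial_scale//; last exact: measurable_eball.
    rewrite -ge0_integral_setU//; last 3 first.
    - exact: measurable_eball.
    - exact: measurable_funTS.
    - by apply/disj_setPS => w /= [[_ w1] w2]; apply: w1.
    by rewrite setUC /shell setDUK//; exact: subshell.
  rewrite EE => h.
  have Sfin : (\int[mu]_(w in shell delta q) (radial gam (tvec w))%:E)%E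
      \is a fin_num.
    have : (rho%:E)%E \is a fin_num by [].
    by rewrite h fin_numD => /andP[].
  move: h; rewrite -(fineK Sfin) -EFinM -EFinD => -[h].
  by congr EFin; rewrite mulrBl mul1r {1}h addrK.
have bnd q : 0 < q < 1 ->
    delta `^ (2 - gam) * q `^ `|2 - gam| * ((1 - q `^ n%:R) / (1 - q) * V delta)
    <= (1 - q `^ (n%:R + 2 - gam)) / (1 - q) * rho
    <= delta `^ (2 - gam) * q `^ (- `|2 - gam|) *
      ((1 - q `^ n%:R) / (1 - q) * V delta).
  move=> q01; have := int_shell_bounds gam d0 q01; rewrite shE// !lee_fin.
  case/andP: q01 => q0 q1; rewrite powR_mulrn ?(ltW q0)//.
  have e A x y : A * (x / (1 - q) * y) = A * (x * y) / (1 - q).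
    by rewrite (mulrAC x) (mulrA A (x * y)).
  by rewrite !e (mulrAC _ (1 - q)^-1 rho) !ler_pM2r ?invr_gt0 ?subr_gt0.
have h01 : \forall h \near (0 : R)^'-, 0 < h + 1 < 1.
  near=> h; apply/andP; split.
    by rewrite -ltrBlDr sub0r; near: h; apply: nbhs_left_gt; rewrite oppr_lt0.
  by rewrite gtrDr; near: h; exact: nbhs_left_lt.
have cstP (x : R) : x @[_ --> (0 : R)^'-] --> x by exact: cvg_cst.
have midP : (1 - (h + 1) `^ (n%:R + 2 - gam)) / (1 - (h + 1)) * rho
    @[h --> (0 : R)^'-] --> (n%:R + 2 - gam) * rho.
  by apply: cvgM => //; exact: powR_slope_cvg.
(* The limit does not depend on [e], so the lower and upper bounds squeeze the middle term. *)
have sideP e : delta `^ (2 - gam) * (h + 1) `^ e *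
      ((1 - (h + 1) `^ n%:R) / (1 - (h + 1)) * V delta) @[h --> (0 : R)^'-]
    --> delta `^ (2 - gam) * 1 * (n%:R * V delta).
  apply: cvgM; apply: cvgM => //; first exact: powR_near1_cvg.
  exact: powR_slope_cvg.
rewrite mulrC; apply/eqP; rewrite eq_le -[delta `^ _]mulr1; apply/andP; split.
  apply: (ler_cvg_to midP (sideP (- `|2 - gam|))).
  near=> h; have : 0 < h + 1 < 1 by near: h.
  by move=> /bnd/andP[].
apply: (ler_cvg_to (sideP `|2 - gam|) midP).
near=> h; have : 0 < h + 1 < 1 by near: h.
by move=> /bnd/andP[].
Unshelve. all: by end_near. Qed.

End radial_integral.

(** * Moments of the ball *)

(** The integers below [size (p - q)] would be one root too many for a nonzero difference. This
    justifies comparing coefficients of [t]. *)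
Lemma horner_ext (R : numDomainType) (p q : {poly R}) :
  (forall x, p.[x] = q.[x]) -> p = q.
Proof.
move=> pq; apply/eqP; rewrite -subr_eq0; apply/negPn/negP => pq0.
pose s := [seq i%:R : R | i <- iota 0 (size (p - q))].
have := max_poly_roots pq0 (rs := s); rewrite size_map size_iota ltnn => h.
suff : false by []; apply: h.
  by apply/allP => x _; rewrite /root hornerD hornerN pq subrr.
by rewrite map_inj_uniq ?iota_uniq// => i j /eqP; rewrite eqr_nat => /eqP.
Qed.

Section moments.
Variables (R : realType) (n : nat) (delta : R).
Hypothesis delta_gt0 : 0 < delta.
Implicit Types (gam : R) (a b c u v w nu xi eta zeta : 'cV[R]_n).

Lemma ball_integrable_radial gam : gam < n%:R + 2 ->
  ball_integrable delta (@radial R n gam).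
Proof.
move=> g2; apply/integrableP; split.
  by apply/measurable_EFinP/measurable_funTS; exact: measurable_radial.
under eq_integral do rewrite abse_EFin (ger0_norm (radial_ge0 _ _)).
exact: radial_integral_lty.
Qed.

(** Comparing [ball_int_radial] at the two exponents eliminates the volume of the ball. *)
Lemma ball_int_radial_shift gam k : gam < n%:R + 2 ->
  ball_int delta (@radial R n (gam - k%:R)) =
  delta ^+ k * (n%:R + 2 - gam) / (n%:R + 2 - gam + k%:R) *
    ball_int delta (@radial R n gam).
Proof.
move=> g2; have g2' : gam - k%:R < n%:R + 2.
  by rewrite ltrBlDr (lt_le_trans g2)// lerDl.
have n2 : n%:R + 2 - gam + k%:R != 0.
  by rewrite gt_eqF// ltr_wpDr// subr_gt0.
have e : ball_int delta (@radial R n (gam - k%:R)) * (n%:R + 2 - gam + k%:R) =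
    delta ^+ k * (ball_int delta (@radial R n gam) * (n%:R + 2 - gam)).
  have -> : n%:R + 2 - gam + k%:R = n%:R + 2 - (gam - k%:R) by ring.
  rewrite (ball_int_radial delta_gt0 g2) (ball_int_radial delta_gt0 g2').
  have -> : 2 - (gam - k%:R) = k%:R + (2 - gam) by ring.
  rewrite powRD ?(gt_eqF delta_gt0) ?implybT//.
  by rewrite powR_mulrn ?(ltW delta_gt0)// -mulrA.
apply: (mulIf n2); rewrite e.
by rewrite mulrAC divfK// -mulrA; congr (_ * _); rewrite mulrC.
Qed.

(** One slot carries the high power and two receive the vectors produced by polarization. A slot
    with exponent [0] contributes [1], whatever its vector. *)
Definition moment_kernel a p b q c r gam w :=
  dotv a w ^+ p * dotv b w ^+ q * dotv c w ^+ r / enorm w `^ gam.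

Definition moment a p b q c r gam := ball_int delta (moment_kernel a p b q c r gam).

Lemma measurable_moment_kernel a p b q c r gam :
  measurable_vec (moment_kernel a p b q c r gam).
Proof.
apply: measurable_funM; last first.
  under eq_fun do rewrite -powRN.
  by apply: (measurableT_comp (measurable_powR _)); exact: measurable_enorm.
apply: measurable_funM; last by apply: measurable_funX; exact: measurable_dotv.
by apply: measurable_funM; apply: measurable_funX; exact: measurable_dotv.
Qed.

Lemma moment_kernel_le a p b q c r gam w : (0 < p + q + r)%N ->
  `|moment_kernel a p b q c r gam w| <=
  enorm a ^+ p * enorm b ^+ q * enorm c ^+ r * radial (gam + 2 - (p + q + r)%:R) w.
Proof.
move=> pqr.
(* Positive total degree makes the kernel vanish at the origin, as [radial] does; elsewhere
   Cauchy-Schwarz bounds each factor. *)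
have [->|w0] := eqVneq w 0.
  rewrite radial0 mulr0 /moment_kernel !(dotvC _ 0) !dotv0l -!exprD.
  by rewrite expr0n gtn_eqF// mul0r normr0.
have -> : radial (gam + 2 - (p + q + r)%:R) w =
    enorm w ^+ (p + q + r) / enorm w `^ gam.
  rewrite radialE// -powR_mulrn ?enorm_ge0// -powRB ?enorm_eq0 ?w0 ?implybT//.
  by congr (_ `^ _); ring.
rewrite /moment_kernel normrM normfV (ger0_norm (powR_ge0 _ _)) mulrA.
rewrite ler_wpM2r ?invr_ge0 ?powR_ge0// !normrM !normrX.
apply: (@le_trans _ _ ((enorm a * enorm w) ^+ p * (enorm b * enorm w) ^+ q *
    (enorm c * enorm w) ^+ r)).
  have h u k : `|dotv u w| ^+ k <= (enorm u * enorm w) ^+ k.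
    by apply: lerXn2r; rewrite ?nnegrE ?mulr_ge0 ?enorm_ge0// cauchy_schwarz.
  by rewrite !ler_pM ?mulr_ge0 ?exprn_ge0.
by rewrite !exprMn !exprD le_eqVlt; apply/orP; left; apply/eqP; ring.
Qed.

Lemma ball_integrable_moment a p b q c r gam : (0 < p + q + r)%N ->
  gam < n%:R + (p + q + r)%:R ->
  ball_integrable delta (moment_kernel a p b q c r gam).
Proof.
move=> pqr g2.
have g2' : gam + 2 - (p + q + r)%:R < n%:R + 2 by rewrite ltrBlDr addrAC ltrD2r.
apply: ball_integrable_le (ball_integrableZ (enorm a ^+ p * enorm b ^+ q *
  enorm c ^+ r) (ball_integrable_radial g2')) _.
  exact: measurable_moment_kernel.
by move=> w wd; exact: moment_kernel_le.
Qed.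

Lemma moment_orthogonal (Q : 'M[R]_n) a p b q c r gam : Q^T *m Q = 1%:M ->
  moment (Q *m a) p (Q *m b) q (Q *m c) r gam = moment a p b q c r gam.
Proof.
move=> QQ; rewrite /moment.
rewrite -(ball_int_orthogonal delta QQ
  (measurable_moment_kernel (Q *m a) p _ q _ r gam)).
apply: eq_ball_int => w; rewrite /moment_kernel.
by rewrite /enorm !dotv_mulmxl !(mulmxA Q^T) QQ !mul1mx.
Qed.

(** Polarization: the binomial theorem makes the moment at [a + t *: b] a polynomial in [t], whose
    linear coefficient must be that of [P]. No differentiation under the integral occurs. *)
Lemma moment_coef1 a b c N r gam (P : {poly R}) : gam < n%:R + (N.+1 + r)%:R ->
  (forall t, moment (a + t *: b) N.+1 c r 0 0 gam = P.[t]) ->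
  N.+1%:R * moment a N b 1 c r gam = P^`().[0].
Proof.
move=> g2 EP.
have int (j : 'I_N.+2) :
    ball_integrable delta (moment_kernel a (N.+1 - j) b j c r gam).
  by apply: ball_integrable_moment; rewrite subnK// -ltnS.
pose p := \poly_(j < N.+2) ('C(N.+1, j)%:R * moment a (N.+1 - j) b j c r gam).
have <- : p = P.
  apply: horner_ext => t; rewrite -EP horner_poly.
  transitivity (\sum_(j < N.+2) ball_int delta (fun w =>
      ('C(N.+1, j)%:R * t ^+ j) * moment_kernel a (N.+1 - j) b j c r gam w)).
    by apply: eq_bigr => j _; rewrite ball_intZ// mulrAC.
  rewrite -ball_int_sum => [|j]; last exact: ball_integrableZ.
  apply: eq_ball_int => w; rewrite /moment_kernel dotvDl dotvZl exprDn.
  rewrite !expr0 !mulr1 !mulr_suml; apply: eq_bigr => j _.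
  by rewrite -mulr_natr exprMn; ring.
by rewrite horner_coef0 coef_deriv coef_poly bin1 subn1.
Qed.

Variable i0 : 'I_n.
Let e0 : 'cV[R]_n := delta_mx i0 0.

(** The constant s_k(gam), computed along the coordinate axis [i0]. *)
Definition axis_moment k gam := moment e0 k.*2.+2 0 0 0 0 gam.

Lemma momentE a k gam : gam < n%:R + k.*2.+2%:R ->
  moment a k.*2.+2 0 0 0 0 gam = dotv a a ^+ k.+1 * axis_moment k gam.
Proof.
move=> g2.
have [Q QQ Qe] : exists2 Q : 'M[R]_n, Q^T *m Q = 1%:M & Q *m (enorm a *: e0) = a.
  by apply: orthogonal_mx_exists; rewrite enormZ ?enorm_ge0// enorm_delta mulr1.
(* The zero vectors of the idle slots are written as [Q *m 0] to fit [moment_orthogonal]. *)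
rewrite -[in LHS]Qe -(mulmx0 1 Q) moment_orthogonal//.
rewrite -sqr_enorm -exprM mul2n doubleS -ball_intZ; last first.
  by apply: ball_integrable_moment; rewrite !addn0.
by apply: eq_ball_int => w; rewrite /moment_kernel dotvZl exprMn; ring.
Qed.

Lemma moment_parallel nu zeta k gam : gam < n%:R + k.*2.+2%:R ->
  moment nu k.*2.+1 zeta 1 0 0 gam =
  dotv nu nu ^+ k * dotv nu zeta * axis_moment k gam.
Proof.
move=> g2.
(* [P] is s_k(gam) times |nu + t zeta|^(2k+2). Its derivative at 0 has the factor 2k + 2, which
   cancels the one from [moment_coef1]. *)
pose P : {poly R} := ((dotv nu nu)%:P + (2 * dotv nu zeta)%:P * 'X +
  (dotv zeta zeta)%:P * 'X ^+ 2) ^+ k.+1 * (axis_moment k gam)%:P.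
have := @moment_coef1 nu zeta 0 k.*2.+1 0 gam P; rewrite addn0 => /(_ g2).
have PE t : moment (nu + t *: zeta) k.*2.+2 0 0 0 0 gam = P.[t].
  rewrite momentE// /P !hornerE; congr (_ ^+ _ * _).
  rewrite !(dotvDl, dotvDr, dotvZl, dotvZr) (dotvC zeta nu).
  by rewrite /=; ring.
move=> /(_ PE); rewrite /P !(poly.derivE, deriv_exp) !(hornerE, hornerMn)/=.
rewrite !(mulr0, mul0r, addr0) => h.
apply: (@mulfI _ k.*2.+2%:R); first by rewrite pnatr_eq0.
rewrite h -mulr_natr (_ : k.*2.+2%:R = 2 * k.+1%:R); first by ring.
by rewrite -natrM mul2n doubleS.
Qed.

(** Polarizes [moment_parallel] at [nu + t *: eta]. By orthogonality the squared norm has no linear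
    term in [t], so only the factor (nu + t eta).zeta contributes. *)
Lemma moment_perp nu eta zeta k gam : gam < n%:R + k.*2.+2%:R -> dotv eta nu = 0 ->
  k.*2.+1%:R * moment nu k.*2 eta 1 zeta 1 gam =
  dotv nu nu ^+ k * dotv eta zeta * axis_moment k gam.
Proof.
move=> g2 en.
pose P : {poly R} := ((dotv nu nu)%:P + (dotv eta eta)%:P * 'X ^+ 2) ^+ k *
  ((dotv nu zeta)%:P + (dotv eta zeta)%:P * 'X) * (axis_moment k gam)%:P.
have := @moment_coef1 nu eta zeta k.*2 1 gam P; rewrite addn1 => /(_ g2).
have PE t : moment (nu + t *: eta) k.*2.+1 zeta 1 0 0 gam = P.[t].
  rewrite moment_parallel// /P !hornerE; congr (_ ^+ _ * _ * _).
    by rewrite !(dotvDl, dotvDr, dotvZl, dotvZr) (dotvC nu eta) en /=; ring.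
  by rewrite dotvDl dotvZl mulrC.
move=> /(_ PE) ->; rewrite /P !(poly.derivE, deriv_exp) !(hornerE, hornerMn)/=.
by rewrite !(mulr0, mul0r, addr0) mul0rn mul0r add0r mulr1.
Qed.

Lemma axis_moment0 gam : gam < n%:R + 2 ->
  n%:R * axis_moment 0 gam = ball_int delta (@radial R n gam).
Proof.
move=> g2.
transitivity (\sum_(i < n) moment (delta_mx i 0) 2 0 0 0 0 gam).
  transitivity (\sum_(i < n) axis_moment 0 gam).
    by rewrite sumr_const card_ord mulr_natl.
  apply: eq_bigr => i _; rewrite (@momentE _ 0 _ g2) dotv_deltal mxE !eqxx.
  by rewrite expr1n mul1r.
rewrite /moment -ball_int_sum => [|i]; last exact: ball_integrable_moment.
apply: eq_ball_int => w; rewrite /radial sqr_enorm /dotv mulr_suml.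
apply: eq_bigr => i _; rewrite /moment_kernel dotv_deltal.
by rewrite !expr0 !mulr1 expr2.
Qed.

(** Summing the squares of all coordinates restores |w|^2 and lowers [gam] by 2. The [i0] term is
    s_(k+1); by [moment_perp] each of the others is s_(k+1) / (2k + 3). *)
Lemma axis_momentS k gam : gam < n%:R + k.*2.+4%:R ->
  (n%:R + k.*2.+2%:R) * axis_moment k.+1 gam =
  k.*2.+3%:R * axis_moment k (gam - 2).
Proof.
move=> g2.
have <- : \sum_(i < n) moment e0 k.+1.*2 (delta_mx i 0) 1 (delta_mx i 0) 1 gam =
    axis_moment k (gam - 2).
  rewrite /moment -ball_int_sum => [|i]; last first.
    by apply: ball_integrable_moment; rewrite !addn1 ?doubleS.
  apply: eq_ball_int => w; rewrite /moment_kernel !expr0 !mulr1.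
  have [->|w0] := eqVneq w 0.
    rewrite (dotvC e0) dotv0l doubleS !expr0n/= mul0r big1// => i _.
    by rewrite !mul0r.
  rewrite powRB ?enorm_eq0 ?w0 ?implybT// powR_mulrn ?enorm_ge0// sqr_enorm.
  rewrite invf_div mulrA [in RHS]/dotv mulr_sumr mulr_suml; apply: eq_bigr => i _.
  by rewrite dotv_deltal !expr1 -!mulrA.
rewrite mulr_sumr (bigD1 i0)//= /e0.
have -> : moment (delta_mx i0 0) k.+1.*2 (delta_mx i0 0) 1 (delta_mx i0 0) 1 gam =
   axis_moment k.+1 gam.
  by apply: eq_ball_int => w; rewrite /moment_kernel !expr0 !mulr1 !expr1 -!exprSr.
rewrite (eq_bigr (fun=> axis_moment k.+1 gam)) => [|i ii0]; last first.
  rewrite -[k.*2.+3]/(k.+1.*2.+1) moment_perp//.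
    by rewrite !dotv_deltal !mxE !eqxx expr1n !mul1r.
  by rewrite dotv_deltal mxE (negbTE ii0).
rewrite sumr_const cardC1 card_ord -[axis_moment _ _ *+ _]mulr_natl.
rewrite -[RHS]mulrDl; congr (_ * _).
(* The count is 2k + 3 + (n - 1); [i0] ensures that the predecessor of [n] is not truncated. *)
rewrite -!natrD; congr _%:R; have := ltn_ord i0; lia.
Qed.

(** [axis_momentS] is iterated [k] times, lowering [gam] by 2 each time, down to [axis_moment0]. *)
Lemma axis_momentE k gam : gam < n%:R + k.*2.+2%:R ->
  axis_moment k gam =
  (\prod_(j < k.+1) (j.*2.+1%:R / (n + j.*2)%:R)) *
  ball_int delta (@radial R n (gam - k.*2%:R)).
Proof.
elim: k gam => [|k IH] gam g2.
  have n0 : n%:R != 0 :> R by rewrite pnatr_eq0 -lt0n (leq_ltn_trans _ (ltn_ord i0)).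
  by rewrite subr0 -axis_moment0// big_ord1 addn0 mul1r mulrA mulVf// mul1r.
have n1 : n%:R + k.*2.+2%:R != 0 :> R by rewrite -natrD pnatr_eq0 addnS.
have g2' : gam - 2 < n%:R + k.*2.+2%:R by rewrite ltrBlDr -addrA -natrD addn2.
apply: (mulfI n1); rewrite (axis_momentS g2) (IH _ g2') [in RHS]big_ord_recr/=.
have -> : gam - k.+1.*2%:R = gam - 2 - k.*2%:R.
  by rewrite doubleS -addn2 natrD; ring.
rewrite doubleS natrD.
move: n1; move: (n%:R : R) (k.*2.+2%:R : R) => x y n1.
by field.
Qed.

End moments.

(** * Termwise integration *)

Section termwise.
Variables (R : realType) (n : nat) (delta : R).
Local Notation T := (n.-tuple (measurableTypeR R)).
Local Notation mu := (@lebesgue_tuple R n).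

(** All partial sums are dominated by the single function [limn (series C) * h]. *)
Lemma ball_int_series (phi : nat -> 'cV[R]_n -> R) (F h : 'cV[R]_n -> R)
    (C : nat -> R) :
  (forall k, measurable_vec (phi k)) -> measurable_vec F ->
  (forall w, series (fun k => phi k w) @ \oo --> F w) ->
  ball_integrable delta h -> (forall w, 0 <= h w) ->
  (forall k, 0 <= C k) -> cvgn (series C) ->
  (forall k w, enorm w < delta -> `|phi k w| <= C k * h w) ->
  ball_integrable delta F /\
  series (fun k => ball_int delta (phi k)) @ \oo --> ball_int delta F.
Proof.
move=> mphi mF phiF hi h0 C0 Ccvg phiC.
have mB := @measurable_eball R n delta.
have iphi k : ball_integrable delta (phi k).
  apply: (ball_integrable_le (mphi k) (ball_integrableZ (C k) hi)) => w.
  exact: phiC.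
have Cle N : series C N <= limn (series C).
  apply: nondecreasing_cvgn_le => //; apply/nondecreasing_seqP => k.
  by rewrite seriesS lerDr.
have [] := @dominated_convergence _ _ _ mu (eball delta) mB
  (fun N w => (series (fun k => phi k (tvec w)) N)%:E) (fun w => (F (tvec w))%:E)
  (fun w => (limn (series C) * h (tvec w))%:E).
- move=> N; apply/measurable_EFinP/measurable_funTS; rewrite /series/=.
  by apply: measurable_sum => k; exact: mphi.
- exact/measurable_EFinP/measurable_funTS.
- by apply: aeW => w _; apply: cvg_EFin => //; [exact: nearW|exact: phiF].
- exact: ball_integrableZ.
- apply: aeW => w N wd; rewrite lee_fin.
  apply: (@le_trans _ _ (series C N * h (tvec w))).
    rewrite /series/= mulr_suml; apply: (le_trans (ler_norm_sum _ _ _)).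
    by apply: ler_sum => k _; exact: phiC.
  by rewrite ler_wpM2r.
move=> iF _ cv; split => //.
have -> : series (fun k => ball_int delta (phi k)) = fun N =>
    fine (\int[mu]_(w in eball delta) (series (fun k => phi k (tvec w)) N)%:E).
  apply/funext => N; rewrite /series/= -(ball_int_sum _ iphi).
  by [].
apply: fine_cvg; rewrite /ball_int /Rintegral fineK//.
exact: (integrable_fin_num mB iF).
Qed.

Lemma ler_inv_fact i j : (i <= j)%N -> j`!%:R^-1 <= i`!%:R^-1 :> R.
Proof.
by move=> ij; rewrite lef_pV2 ?posrE ?ltr0n ?fact_gt0// ler_nat; exact: leq_fact.
Qed.

Lemma exp_coeff_ge0 (x : R) k : 0 <= x -> 0 <= exp_coeff x k.
Proof. by move=> x0; rewrite /exp_coeff/= divr_ge0// exprn_ge0. Qed.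

Hypothesis delta_gt0 : 0 < delta.
Implicit Types (a b nu : 'cV[R]_n) (beta : R).

Lemma radial_shift_le gam k (w : 'cV[R]_n) : enorm w < delta ->
  radial (gam - k%:R) w <= delta ^+ k * radial gam w.
Proof.
move=> wd; have [->|w0] := eqVneq w 0; first by rewrite !radial0 mulr0.
rewrite !radialE// (_ : 2 - (gam - k%:R) = k%:R + (2 - gam)); last by ring.
rewrite powRD ?enorm_eq0 ?w0 ?implybT// powR_mulrn ?enorm_ge0//.
rewrite ler_wpM2r ?powR_ge0//.
by apply: lerXn2r; rewrite ?nnegrE ?enorm_ge0// ltW.
Qed.

Lemma moment_kernel_bound nu p a q b r gam beta k (w : 'cV[R]_n) :
  (0 < p + q + r)%N -> gam + 2 - (p + q + r)%:R = beta - k%:R -> enorm w < delta ->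
  `|moment_kernel nu p a q b r gam w| <=
  enorm nu ^+ p * enorm a ^+ q * enorm b ^+ r * (delta ^+ k * radial beta w).
Proof.
move=> pqr gE wd; apply: (le_trans (moment_kernel_le _ _ _ _ _ pqr)).
by rewrite ler_wpM2l ?mulr_ge0 ?exprn_ge0 ?enorm_ge0// gE radial_shift_le.
Qed.

(** The relation [gE] makes the lowest-order kernel comparable to [radial beta], which is
    integrable; each further power of w.w is bounded by [delta ^+ 2]. *)
Lemma ball_int_power_series (f : R -> R) (c : nat -> R) p nu a q b r gam beta :
  measurable_fun setT f ->
  (forall m, `|c m| <= m`!%:R^-1) ->
  (forall x, series (fun m => c m * x ^+ (m.*2 + p)) @ \oo --> f x) ->
  (0 < p + q + r)%N -> gam + 2 - (p + q + r)%:R = beta -> beta < n%:R + 2 ->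
  let F w := f (dotv nu w) / enorm w `^ gam * (dotv a w ^+ q * dotv b w ^+ r) in
  ball_integrable delta F /\
  series (fun m => c m * moment delta nu (m.*2 + p) a q b r gam) @ \oo -->
    ball_int delta F.
Proof.
move=> mf cm cf pqr gE b2 F.
pose phi m w := c m * moment_kernel nu (m.*2 + p) a q b r gam w.
have pqrm m : (0 < m.*2 + p + q + r)%N by lia.
have km m : gam + 2 - (m.*2 + p + q + r)%:R = beta - m.*2%:R.
  by rewrite -gE -!addnA natrD; ring.
have ki m : ball_integrable delta (moment_kernel nu (m.*2 + p) a q b r gam).
  apply: ball_integrable_moment => //.
  have := km m; have : 0 <= m.*2%:R :> R by []. lra.
pose D := enorm nu ^+ p * enorm a ^+ q * enorm b ^+ r.
(* The bound 1/m! on the coefficients yields the terms of an exponential series, hence a summable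
   majorant. *)
pose C m := D * exp_coeff ((enorm nu * delta) ^+ 2) m.
have D0 : 0 <= D by rewrite !mulr_ge0 ?exprn_ge0 ?enorm_ge0.
have [] := @ball_int_series phi F (@radial R n beta) C.
- move=> m; apply: measurable_funM => //; exact: measurable_moment_kernel.
- apply: measurable_funM; last first.
    by apply: measurable_funM; apply: measurable_funX; exact: measurable_dotv.
  apply: measurable_funM.
    by apply: (measurableT_comp mf); exact: measurable_dotv.
  under eq_fun do rewrite -powRN.
  by apply: (measurableT_comp (measurable_powR _)); exact: measurable_enorm.
- move=> w; pose K := (enorm w `^ gam)^-1 * (dotv a w ^+ q * dotv b w ^+ r).
  rewrite /F -mulrA -/K.
  have : series (fun m => c m * dotv nu w ^+ (m.*2 + p)) N * K
      @[N --> \oo] --> f (dotv nu w) * K.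
    by apply: cvgM; [exact: cf|exact: cvg_cst].
  apply: cvg_trans; apply: near_eq_cvg; apply: nearW => N.
  rewrite /series/= mulr_suml; apply: eq_bigr => m _.
  by rewrite /phi /moment_kernel /K; ring.
- exact: ball_integrable_radial.
- exact: radial_ge0.
- by move=> m; rewrite /C mulr_ge0// exp_coeff_ge0// sqr_ge0.
- exact/is_cvg_seriesZ/is_cvg_series_exp_coeff.
- move=> m w wd; rewrite /phi normrM.
  have := moment_kernel_bound nu a b (pqrm m) (km m) wd.
  move=> /(ler_pM _ _ (cm m)) h; apply: (le_trans (h _ _)) => //.
  rewrite /C /exp_coeff/= le_eqVlt; apply/orP; left; apply/eqP.
  have e (x : R) : x ^+ m.*2 = (x ^+ 2) ^+ m by rewrite -mul2n exprM.
  by rewrite /D exprD !e !exprMn; ring.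
by move=> iF h; split => //; under eq_fun do rewrite -ball_intZ//.
Qed.

Lemma cos_shift_series (x : R) :
  series (fun m => (-1) ^+ m.+1 / (m.*2 + 2)`!%:R * x ^+ (m.*2 + 2)) @ \oo -->
    cos x - 1.
Proof.
have := @cvg_cos_coeff' _ x; rewrite -cvg_shiftS => /= h.
have : (series (cos_coeff' x) N.+1 - 1) @[N --> \oo] --> cos x - 1.
  by apply: cvgB => //; exact: cvg_cst.
apply: cvg_trans; apply: near_eq_cvg; apply: nearW => N.
rewrite /series/= big_nat_recl// /cos_coeff' expr0 mul1r divr1 addrC addKr.
by apply: eq_bigr => i _; rewrite addn2 doubleS exprnP mulrAC.
Qed.

Lemma sin_shift_series (x : R) :
  series (fun m => (-1) ^+ m / (m.*2 + 1)`!%:R * x ^+ (m.*2 + 1)) @ \oo --> sin x.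
Proof.
have := @cvg_sin_coeff' _ x; apply: cvg_trans; apply: near_eq_cvg; apply: nearW => N.
by apply: eq_bigr => i _; rewrite /sin_coeff' addn1 exprnP mulrAC.
Qed.

Let norm_coef m k l : (m <= k)%N -> `|(-1) ^+ l / k`!%:R| <= m`!%:R^-1 :> R.
Proof.
move=> mk; rewrite normrM normrX normrN1 expr1n mul1r normfV normr_nat.
exact: ler_inv_fact.
Qed.

Lemma ball_int_cos nu a b beta : beta < n%:R + 2 ->
  let F w := (cos (dotv nu w) - 1) / enorm w `^ (beta + 2) *
    (dotv a w ^+ 1 * dotv b w ^+ 1) in
  ball_integrable delta F /\
  series (fun m => (-1) ^+ m.+1 / (m.*2 + 2)`!%:R *
    moment delta nu (m.*2 + 2) a 1 b 1 (beta + 2)) @ \oo --> ball_int delta F.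
Proof.
move=> b2; apply: (@ball_int_power_series (fun x => cos x - 1)) => //.
- apply: measurable_funB => //; apply: continuous_measurable_fun.
  exact: continuous_cos.
- by move=> m; apply: norm_coef; rewrite -addnn -addnA leq_addr.
- exact: cos_shift_series.
- by rewrite !natrD; lra.
Qed.

(** The factor with exponent [0] fits the integrand to the two test slots of
    [ball_int_power_series]. *)
Lemma ball_int_sin nu a beta : beta < n%:R + 2 ->
  let F w := sin (dotv nu w) / enorm w `^ beta * (dotv a w ^+ 1 * dotv a w ^+ 0) in
  ball_integrable delta F /\
  series (fun m => (-1) ^+ m / (m.*2 + 1)`!%:R *
    moment delta nu (m.*2 + 1) a 1 a 0 beta) @ \oo --> ball_int delta F.
Proof.
move=> b2; apply: (@ball_int_power_series sin) => //.
- by apply: continuous_measurable_fun; exact: continuous_sin.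
- by move=> m; apply: norm_coef; rewrite -addnn -addnA leq_addr.
- exact: sin_shift_series.
- by rewrite addrK.
Qed.

End termwise.

(** * Identification of the hypergeometric series *)

Section pochhammer.
Variable R : realType.
Implicit Types (x : R) (k m n : nat).

Lemma pochhammerS x k : pochhammer x k.+1 = pochhammer x k * (x + k%:R).
Proof. by rewrite /pochhammer big_ord_recr. Qed.

Lemma pochhammerSl x k : pochhammer x k.+1 = x * pochhammer (x + 1) k.
Proof.
rewrite /pochhammer big_ord_recl addr0; congr (_ * _); apply: eq_bigr => i _.
by rewrite lift0 -natr1; ring.
Qed.

Lemma pochhammer_gt0 x k : 0 < x -> 0 < pochhammer x k.
Proof. by move=> x0; apply: prodr_gt0 => i _; rewrite ltr_pwDl. Qed.

(** Both cross products equal (x)_(k+1). In this way a parameter pair x over x + 1 encodes the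
    factor produced by integrating a power of the norm. *)
Lemma pochhammer_ratio x k : 0 < x ->
  pochhammer x k / pochhammer (x + 1) k = x / (x + k%:R).
Proof.
move=> x0; have xk : x + k%:R != 0 by rewrite gt_eqF// ltr_pwDl.
have p1 : pochhammer (x + 1) k != 0 by rewrite gt_eqF// pochhammer_gt0// addr_gt0.
by apply/eqP; rewrite eqr_div// -pochhammerS pochhammerSl.
Qed.

Lemma pochhammer1 k : pochhammer (1 : R) k = k`!%:R.
Proof.
elim: k => [|k IH]; first by rewrite /pochhammer big_ord0.
by rewrite pochhammerS IH factS mulnC natrM -natr1 addrC.
Qed.

(** The numerator is (2m+1)!! = (2m+1)! / (2^m m!), and the denominator is n 2^m ((n+2)/2)_m. *)
Lemma moment_coefE n m : (0 < n)%N ->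
  \prod_(j < m.+1) (j.*2.+1%:R / (n + j.*2)%:R) =
  (m.*2.+1)`!%:R / (n%:R * 4 ^+ m * m`!%:R * pochhammer ((n%:R + 2) / 2) m) :> R.
Proof.
move=> n0; have n0' : n%:R != 0 :> R by rewrite pnatr_eq0 -lt0n.
elim: m => [|m IH].
  rewrite big_ord1 addn0 /pochhammer big_ord0 expr0 fact0.
  by rewrite !mulr1.
rewrite big_ord_recr/= IH pochhammerS.
have p0 : pochhammer ((n%:R + 2) / 2) m != 0 :> R.
  by rewrite gt_eqF// pochhammer_gt0// divr_gt0// ltr_wpDl.
have d : m.*2.+2%:R = 2 * m.+1%:R :> R by rewrite -natrM mul2n doubleS.
have n1 : (n%:R + 2) / 2 + m%:R = (n%:R + m.*2.+2%:R) / 2 :> R.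
  by rewrite d -[m.+1%:R]natr1; field.
have n2 : n%:R + m.*2.+2%:R != 0 :> R by rewrite -natrD pnatr_eq0 addnS.
have f0 : m`!%:R != 0 :> R by rewrite pnatr_eq0 -lt0n fact_gt0.
have m1 : m.+1%:R != 0 :> R by rewrite pnatr_eq0.
rewrite n1 doubleS natrD exprS (factS m.*2.+2) (factS m.*2.+1) (factS m) !natrM.
move: n2; rewrite d; move: (pochhammer _ m : R) p0 => z z0.
move: (m.*2.+3%:R : R) (m.+1%:R : R) (n%:R : R) (m`!%:R : R) m1 n0' f0.
move=> u v x y v0 x0 y0 n2.
by field; rewrite n2 z0 y0 v0 x0 expf_neq0 ?pnatr_eq0.
Qed.

Lemma pochhammer_2 k : pochhammer (2 : R) k = k.+1`!%:R.
Proof. by rewrite -pochhammer1 pochhammerSl mul1r. Qed.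

(** (3/2)_(k+1) is peeled from both ends. The pair 5/2 over 3/2 encodes the factor 2k + 3 that
    separates the parallel from the orthogonal direction. *)
Lemma pochhammer_52 k :
  pochhammer (5 / 2 : R) k = pochhammer (3 / 2) k * (k.*2.+3%:R / 3).
Proof.
have := pochhammerSl (3 / 2) k; rewrite pochhammerS.
have -> : 3 / 2 + 1 = 5 / 2 :> R by field.
have -> : k.*2.+3%:R = 2 * k%:R + 3 :> R by rewrite -addn3 natrD -mul2n natrM.
move=> h; apply: (@mulfI _ (3 / 2)); first by rewrite mulf_neq0 ?invr_eq0 ?pnatr_eq0.
by rewrite -h; field.
Qed.

End pochhammer.

(** * Eigenvalues of the multiplier *)

Section eigenvalues.
Variables (R : realType) (n : nat) (delta beta : R).
Hypotheses (n_gt0 : (0 < n)%N) (delta_gt0 : 0 < delta) (betan : beta < n%:R + 2).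
Implicit Types nu eta zeta : 'cV[R]_n.

Local Notation rho := (ball_int delta (@radial R n beta)).

(** Positivity of the measure of the ball gives this; it allows [rho] to cancel against [cdb], which
    is built from its inverse. *)
Lemma ball_int_radial_neq0 : rho != 0.
Proof.
suff : rho * (n%:R + 2 - beta) != 0 by rewrite mulf_eq0 negb_or => /andP[].
rewrite ball_int_radial// gt_eqF// !mulr_gt0 ?powR_gt0 ?ltr0n//.
by rewrite fine_gt0// eball_gt0//= -ge0_fin_numE// eball_fin_num.
Qed.

(** Lets [pFq], defined by [limn], be evaluated from termwise integration: for nonzero [d],
    convergence of [u] follows from that of the scaled series. For [d = 0] both sides vanish, even
    if the limit is a default value. *)
Lemma series_scale (d : R) (u : nat -> R) l :
  series (fun k => d * u k) @ \oo --> l -> l = d * limn (series u).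
Proof.
move=> ul; have [d0|d0] := eqVneq d 0.
  rewrite d0 mul0r; apply: (cvg_unique _ ul) => //.
  rewrite (_ : series _ = cst 0); first exact: cvg_cst.
  by apply/funext => k; rewrite /series/= big1// => i _; rewrite d0 mul0r.
have uE : series u = fun k => d^-1 * series (fun k => d * u k) k.
  by apply/funext => k; rewrite /series/= -mulr_sumr mulKf.
have : series u @ \oo --> d^-1 * l by rewrite uE; apply: cvgM => //; exact: cvg_cst.
by move/cvg_lim => ->//; rewrite mulVKf.
Qed.

Local Notation i0 := (Ordinal n_gt0).
Local Notation N nu := (dotv nu nu).
Local Notation z nu := (- (1 / 4) * enorm nu ^+ 2 * delta ^+ 2).

Let a : R := (n%:R + 2 - beta) / 2.

Let a_gt0 : 0 < a.
Proof. by rewrite divr_gt0// subr_gt0. Qed.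

Let a1E : (n%:R + 4 - beta) / 2 = a + 1.
Proof. by rewrite /a; field. Qed.

Let radial_ratio m :
  ball_int delta (@radial R n (beta - m.*2%:R)) =
  delta ^+ m.*2 * (pochhammer a m / pochhammer (a + 1) m) * rho.
Proof.
rewrite ball_int_radial_shift// pochhammer_ratio//; congr (_ * _).
rewrite -mulrA; congr (_ * _).
rewrite /a (_ : m.*2%:R = 2 * m%:R); last by rewrite -natrM mul2n.
have : n%:R + 2 - beta + 2 * m%:R != 0.
  by rewrite gt_eqF// ltr_wpDr ?mulr_ge0// subr_gt0.
move: (n%:R : R) (m%:R : R) => x y xy. 
by field; rewrite (mulrC y).
Qed.

Let axis_moment_sin m : axis_moment delta i0 m beta =
  (m.*2.+1)`!%:R / (n%:R * 4 ^+ m * m`!%:R * pochhammer ((n%:R + 2) / 2) m) *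
  (delta ^+ m.*2 * (pochhammer a m / pochhammer (a + 1) m) * rho).
Proof.
rewrite axis_momentE//; last by rewrite (lt_le_trans betan)// lerD2l ler_nat.
by rewrite moment_coefE// radial_ratio.
Qed.

Let cos_degree m : beta + 2 < n%:R + m.+1.*2.+2%:R.
Proof.
rewrite doubleS -ltrBrDr (lt_le_trans betan)// -addrA lerD2l lerBrDr.
by rewrite -natrD ler_nat.
Qed.

(** Peeling (n+2)/2 off the Pochhammer symbol turns its parameter into (n+4)/2; with one factor 4 it
    leaves 2 (n+2). *)
Let axis_moment_cos m : axis_moment delta i0 m.+1 (beta + 2) =
  (m.*2.+3)`!%:R / (n%:R * (n%:R + 2) * 2 * 4 ^+ m * m.+1`!%:R *
    pochhammer ((n%:R + 4) / 2) m) *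
  (delta ^+ m.*2 * (pochhammer a m / pochhammer (a + 1) m) * rho).
Proof.
rewrite axis_momentE//.
rewrite moment_coefE// pochhammerSl.
have -> : beta + 2 - m.+1.*2%:R = beta - m.*2%:R.
  by rewrite doubleS -addn2 natrD; ring.
rewrite radial_ratio doubleS exprS; congr (_ / _ * _).
have -> : (n%:R + 2) / 2 + 1 = (n%:R + 4) / 2 :> R by field.
by field.
Qed.

Let hyper nu k : z nu ^+ k = (-1) ^+ k * N nu ^+ k * delta ^+ k.*2 / 4 ^+ k.
Proof.
rewrite sqr_enorm -mul2n exprM -exprVn -!exprMn; congr (_ ^+ _); by field.
Qed.

Let fact_neq0 k : k`!%:R != 0 :> R.
Proof. by rewrite pnatr_eq0 -lt0n fact_gt0. Qed.

Let factSr k : k.+1`!%:R = k.+1%:R * k`!%:R :> R.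
Proof. by rewrite -natrM. Qed.

Let nz_n2 : n%:R + 2 != 0 :> R.
Proof. by rewrite gt_eqF// ltr_wpDl. Qed.

Let nz_n : n%:R != 0 :> R.
Proof. by rewrite pnatr_eq0 -lt0n. Qed.

Let expr4_neq0 k : 4 ^+ k != 0 :> R.
Proof. by rewrite expf_neq0 ?pnatr_eq0. Qed.

Let poch_neq0 (x : R) k : 0 < x -> pochhammer x k != 0.
Proof. by move=> x0; rewrite gt_eqF// pochhammer_gt0. Qed.

Let half_gt0 k : 0 < (n%:R + k.+1%:R) / 2 :> R.
Proof. by rewrite divr_gt0// ltr_wpDl. Qed.

Let a1_gt0 : 0 < a + 1.
Proof. exact: addr_gt0. Qed.

Lemma ball_int_sinE nu zeta :
  ball_int delta (fun w => sin (dotv nu w) / enorm w `^ beta *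
    (dotv zeta w ^+ 1 * dotv zeta w ^+ 0)) =
  dotv nu zeta * (rho / n%:R) *
  pFq [:: a] [:: (n%:R + 2) / 2; (n%:R + 4 - beta) / 2] (z nu).
Proof.
have [_ h] := ball_int_sin delta_gt0 nu zeta betan.
apply: series_scale; apply: cvg_trans h; apply: near_eq_cvg; apply: nearW => k.
apply: eq_bigr => m _.
rewrite addn1.
have -> : moment delta nu m.*2.+1 zeta 1 zeta 0 beta =
  moment delta nu m.*2.+1 zeta 1 0 0 beta.
  by apply: eq_ball_int => w; rewrite /moment_kernel !expr0.
rewrite (moment_parallel delta_gt0 i0); last first.
  by rewrite (lt_le_trans betan)// lerD2l ler_nat.
rewrite axis_moment_sin hyper a1E !big_cons !big_nil !mulr1.
move: (fact_neq0 m.*2.+1) (fact_neq0 m) (nz_n) (expr4_neq0 m) (poch_neq0 m a_gt0).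
move: (poch_neq0 m (half_gt0 1)) (poch_neq0 m a1_gt0).
move: (pochhammer _ _) (pochhammer _ _) (pochhammer _ _).
move=> p q r p0 q0 f1 f2 n0 e4 r0.
by field; rewrite f1 f2 n0 e4 p0 q0.
Qed.

(** After cancelling factorials the terms carry (2m+3) / (m+1)!. Here 1/(m+1)! is (1)_m / ((2)_m m!)
    and 2m + 3 is 3 (5/2)_m / (3/2)_m. *)
Lemma ball_int_cos_parallel nu zeta :
  ball_int delta (fun w => (cos (dotv nu w) - 1) / enorm w `^ (beta + 2) *
    (dotv nu w ^+ 1 * dotv zeta w ^+ 1)) =
  - (N nu * dotv nu zeta) * (3 * rho / (2 * n%:R * (n%:R + 2))) *
  pFq [:: 1; 5 / 2; a] [:: 2; 3 / 2; (n%:R + 4) / 2; (n%:R + 4 - beta) / 2] (z nu).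
Proof.
have [_ h] := ball_int_cos delta_gt0 nu nu zeta betan.
apply: series_scale; apply: cvg_trans h; apply: near_eq_cvg; apply: nearW => k.
apply: eq_bigr => m _; rewrite addn2.
have -> : moment delta nu m.*2.+2 nu 1 zeta 1 (beta + 2) =
  moment delta nu m.+1.*2.+1 zeta 1 0 0 (beta + 2).
  by apply: eq_ball_int => w; rewrite /moment_kernel -exprD addn1 doubleS mulr1.
rewrite (moment_parallel delta_gt0 i0)//.
rewrite axis_moment_cos hyper a1E !big_cons !big_nil !mulr1.
rewrite pochhammer1 pochhammer_2 pochhammer_52 (factSr m.*2.+2) (factSr m) !exprS.
have h32 : 0 < 3 / 2 :> R by rewrite divr_gt0.
have m1 : m.+1%:R != 0 :> R by rewrite pnatr_eq0.
move: (fact_neq0 m.*2.+2) (fact_neq0 m) (expr4_neq0 m) m1.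
move: (m.*2.+2)`!%:R (m`!%:R) (4 ^+ m) (m.+1%:R) (m.*2.+3%:R).
move: (poch_neq0 m (half_gt0 3)) (poch_neq0 m a1_gt0) (poch_neq0 m h32).
move: (pochhammer ((n%:R + 4) / 2) m) (pochhammer (a + 1) m) (pochhammer (3 / 2) m).
move: nz_n nz_n2; move: (n%:R : R) => x x0 x1 p q r p0 q0 r0 f g y s l f0 g0 y0 s0.
by field; rewrite g0 y0 q0 p0 r0 s0 x1 x0 f0.
Qed.

(** [moment_perp] divides by 2m + 3, which removes the pair 5/2 over 3/2 and the constant 3 of the
    parallel case. *)
Lemma ball_int_cos_perp nu eta zeta : dotv eta nu = 0 ->
  ball_int delta (fun w => (cos (dotv nu w) - 1) / enorm w `^ (beta + 2) *
    (dotv eta w ^+ 1 * dotv zeta w ^+ 1)) =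
  - (N nu * dotv eta zeta) * (rho / (2 * n%:R * (n%:R + 2))) *
  pFq [:: 1; a] [:: 2; (n%:R + 4) / 2; (n%:R + 4 - beta) / 2] (z nu).
Proof.
move=> en; have [_ h] := ball_int_cos delta_gt0 nu eta zeta betan.
apply: series_scale; apply: cvg_trans h; apply: near_eq_cvg; apply: nearW => k.
apply: eq_bigr => m _; rewrite addn2.
have m3 : m.*2.+3%:R != 0 :> R by rewrite pnatr_eq0.
have -> : moment delta nu m.*2.+2 eta 1 zeta 1 (beta + 2) =
    m.*2.+3%:R^-1 *
    (N nu ^+ m.+1 * dotv eta zeta * axis_moment delta i0 m.+1 (beta + 2)).
  rewrite -(@moment_perp _ _ _ delta_gt0 i0 nu eta zeta m.+1)//.
  by rewrite doubleS mulKf.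
rewrite axis_moment_cos hyper a1E !big_cons !big_nil !mulr1.
rewrite pochhammer1 pochhammer_2 (factSr m.*2.+2) (factSr m) !exprS.
have m1 : m.+1%:R != 0 :> R by rewrite pnatr_eq0.
move: (fact_neq0 m.*2.+2) (fact_neq0 m) (expr4_neq0 m) m1 m3.
move: (m.*2.+2)`!%:R (m`!%:R) (4 ^+ m) (m.+1%:R) (m.*2.+3%:R).
move: (poch_neq0 m (half_gt0 3)) (poch_neq0 m a1_gt0).
move: (pochhammer ((n%:R + 4) / 2) m) (pochhammer (a + 1) m).
move: nz_n nz_n2; move: (n%:R : R) => x x0 x1 p q p0 q0 f g y s l f0 g0 y0 s0 l0.
by field; rewrite g0 y0 q0 p0 s0 x1 x0 f0 l0.
Qed.

(** Linearity moves the sum over columns inside the integral; integrability of each entry comes from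
    [ball_int_cos]. *)
Lemma M_b_mulmx mu nu eta i :
  (M_b delta beta mu nu *m eta) i 0 =
  (n%:R + 2) * mu * cdb n delta beta *
  ball_int delta (fun w => (cos (dotv nu w) - 1) / enorm w `^ (beta + 2) *
    (dotv eta w ^+ 1 * dotv (delta_mx i 0) w ^+ 1)).
Proof.
rewrite /M_b -scalemxAl mxE; congr (_ * _); rewrite mxE.
have h j := (ball_int_cos delta_gt0 nu (delta_mx j 0) (delta_mx i 0) betan).1.
transitivity (\sum_j ball_int delta (fun w => eta j 0 *
    ((cos (dotv nu w) - 1) / enorm w `^ (beta + 2) *
     (dotv (delta_mx j 0) w ^+ 1 * dotv (delta_mx i 0) w ^+ 1)))).
  apply: eq_bigr => j _; rewrite ball_intZ; last exact: h.
  rewrite mxE mulrC; congr (_ * _); apply: eq_ball_int => w.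
  by rewrite !mxE !dotv_deltal !expr1 (mulrC (w i 0)).
rewrite -ball_int_sum => [|j]; last by apply: ball_integrableZ; exact: h.
apply: eq_ball_int => w; rewrite {3}/dotv expr1 mulr_suml mulr_sumr.
by apply: eq_bigr => j _; rewrite dotv_deltal; ring.
Qed.

(** Being a multiple of [nu], this vector makes [M_s] a multiple of [outer nu nu], which annihilates
    the vectors orthogonal to [nu]. *)
Lemma sin_intE nu :
  sin_int delta beta nu = (rho / n%:R *
  pFq [:: a] [:: (n%:R + 2) / 2; (n%:R + 4 - beta) / 2] (z nu)) *: nu.
Proof.
apply/colP => i; rewrite !mxE mulrC mulrA -[nu i 0]dotv_deltal dotvC -ball_int_sinE.
by apply: eq_ball_int => w; rewrite !mxE dotv_deltal expr1 expr0 mulr1.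
Qed.

Lemma cdb_radial : cdb n delta beta = 2 * n%:R / rho.
Proof. by rewrite /cdb invfM invrK. Qed.

Lemma outer_mulmx u v eta : outer u v *m eta = dotv v eta *: u.
Proof.
apply/colP => i; rewrite !mxE mulr_suml; apply: eq_bigr => j _.
by rewrite mxE; ring.
Qed.

End eigenvalues.

Theorem theorem1 (R : realType) (n : nat) (delta beta mu lambda : R)
    (nu : 'cV[R]_n) :
  (1 <= n)%N -> 0 < delta -> beta < n%:R + 2 ->
  let M := multiplier delta beta mu lambda nu in
  let z := - (1 / 4) * enorm nu ^+ 2 * delta ^+ 2 in
  let lambda1 := - enorm nu ^+ 2 *
    (3 * mu *
       pFq [:: 1; 5 / 2; (n%:R + 2 - beta) / 2]
           [:: 2; 3 / 2; (n%:R + 4) / 2; (n%:R + 4 - beta) / 2] z +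
     (lambda - mu) *
       pFq [:: (n%:R + 2 - beta) / 2]
           [:: (n%:R + 2) / 2; (n%:R + 4 - beta) / 2] z ^+ 2) in
  let lambda2 := - mu * enorm nu ^+ 2 *
    pFq [:: 1; (n%:R + 2 - beta) / 2]
        [:: 2; (n%:R + 4) / 2; (n%:R + 4 - beta) / 2] z in
  M *m nu = lambda1 *: nu /\
  (forall eta : 'cV[R]_n, dotv eta nu = 0 -> M *m eta = lambda2 *: eta).
Proof.
move=> n0 d0 b2 M z lambda1 lambda2.
have rho0 := ball_int_radial_neq0 n0 d0 b2.
have n0' : n%:R != 0 :> R by rewrite pnatr_eq0 -lt0n.
have n2 : n%:R + 2 != 0 :> R by rewrite gt_eqF// ltr_wpDl.
split=> [|eta en]; apply/colP => i; rewrite mulmxDl mxE M_b_mulmx//.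
(* With c = 2n / rho, the constants collapse: (n+2) c 3 rho / (2n(n+2)) = 3 and (c^2 / 4) (rho /
   n)^2 = 1. *)
- rewrite ball_int_cos_parallel// /M_s -scalemxAl outer_mulmx sin_intE// cdb_radial.
  rewrite !mxE dotvZl dotvC dotv_deltal -/z /lambda1 sqr_enorm.
  move: (pFq _ _ _) (pFq _ _ _) => F G.
  move: (n%:R : R) (ball_int _ _) n0' n2 rho0 => x r x0 x2 r0.
  by field; rewrite x2 r0 x0.
(* The sine part vanishes by [en], and (n+2) c rho / (2n(n+2)) = 1 leaves [mu] alone. *)
- rewrite ball_int_cos_perp// /M_s -scalemxAl outer_mulmx sin_intE// cdb_radial.
  rewrite !mxE dotvZl (dotvC nu) en dotvC dotv_deltal -/z /lambda2 sqr_enorm.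
  move: (pFq _ _ _) (pFq _ _ _) => F G.
  move: (n%:R : R) (ball_int _ _) n0' n2 rho0 => x r x0 x2 r0.
  by field; rewrite x2 r0 x0.
Qed.
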